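(* Let $b\in(0,1]$, $z\ge 0$ and $t>0$. The drawdown $\Delta_z^b(t)$ has the distribution function $$\mathbb P[\Delta_z^b(t)\leq \delta] = \Phi\Bigl(\frac{\delta-z+t\mu(b)}{\sqrt{t}\,\sigma(b)}\Bigr)-\exp\Bigl\{-2\delta\frac{\mu(b)}{\sigma^2(b)}\Bigr\}\,\Phi\Bigl(\frac{-\delta-z+t\mu(b)}{\sqrt{t}\,\sigma(b)}\Bigr),\qquad \delta\ge 0,$$ and it has the density $$f_{\Delta_z^b(t)}(\delta) = \Bigl[\frac1{\sqrt{2\pi t}\, \sigma(b)} \Bigl(\exp\Bigl\{-\frac{(\delta + z+ t \mu(b))^2 - 4 t \mu(b) z}{2 t\sigma^2(b)}\Bigr\}+ \exp\Bigl\{-\frac{(\delta-z+ \mu(b)t)^2}{2 t \sigma^2(b)}\Bigr\}\Bigr)+ \frac{2 \mu(b)}{\sigma^2(b)}\,\Phi\Bigl(\frac{t \mu(b) - \delta-z}{\sqrt{t}\,\sigma(b)}\Bigr)\,e^{-2\delta \mu(b)/\sigma^2(b)}\Bigr] \mathbf 1_{\{\delta > 0\}}.$$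
   Context: Let $W$ be a standard Brownian motion, $\eta<\theta$ real constants and $\sigma>0$. For $b\in[0,1]$ put $\mu(b)=\eta-(1-b)\theta$, $\sigma(b)=\sigma b$, and $\sigma^2(b)=\sigma(b)^2$. Let $X_0^b(t)=\mu(b)t+\sigma(b)W_t$. For $z\ge0$, the drawdown process with initial drawdown $z$ under the constant retention level $b$ is $$\Delta_z^b(t)=\max\Bigl\{z,\sup_{0\le s\le t}X_0^b(s)\Bigr\}-X_0^b(t).$$ $\Phi$ is the standard normal distribution function. *)

(* Defs.v *)
From HB Require Import structures.
From mathcomp Require Import all_boot all_order all_algebra.
From mathcomp Require Import all_classical all_reals all_analysis.
From mathcomp Require Import measurable_realfun.

Set Implicit Arguments.
Unset Strict Implicit.
Unset Printing Implicit Defensive.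

Import Order.TTheory GRing.Theory Num.Theory.
Import numFieldNormedType.Exports.

Local Open Scope classical_set_scope.
Local Open Scope ring_scope.

Definition Phi {R : realType} (x : R) : R :=
  fine (normal_prob 0 1 `]-oo, x]).

(* Mutual independence of a finite family. Product rules for subfamilies are
   the instances with B i = setT for the omitted indices. *)
Definition mutually_independent {d : measure_display} {T : measurableType d}
    {R : realType} (P : probability T R) (I : finType)
    (X : I -> {RV P >-> R}) : Prop :=
  forall B : I -> set R, (forall i, measurable (B i)) ->
  P [set w | forall i, B i (X i w)] = (\prod_(i : I) P (X i @^-1` B i))%E.

(* The time set is [0, +oo[; the values of W at negative times are
   unconstrained and irrelevant. Every path is required to be continuous, so
   that its running suprema are measurable without completing P. *)
Record brownian_motion {d : measure_display} {T : measurableType d}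
    {R : realType} (P : probability T R) (W : R -> {RV P >-> R}) : Prop :=
  BrownianMotion {
  bm_start : {ae P, forall w, W 0 w = 0} ;
  bm_indep : forall (n : nat) (s : nat -> R),
    0 <= s 0%N -> (forall i, (i < n)%N -> s i < s i.+1) ->
    mutually_independent (fun i : 'I_n => W (s i.+1) \- W (s i) : {RV P >-> R}) ;
  bm_gauss : forall s t : R, 0 <= s -> s < t ->
    forall A : set R, measurable A ->
    distribution P (W t \- W s) A = normal_prob 0 (Num.sqrt (t - s)) A ;
  bm_path : forall w : T,
    {within `[0, +oo[, continuous (fun t : R => W t w)}
}.

Definition drift {R : realType} (eta theta b : R) : R :=
  eta - (1 - b) * theta.

Definition volatility {R : realType} (sigma b : R) : R := sigma * b.

Definition surplus {d : measure_display} {T : measurableType d} {R : realType}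
    {P : probability T R} (W : R -> {RV P >-> R}) (eta theta sigma b : R)
    (t : R) (w : T) : R :=
  drift eta theta b * t + volatility sigma b * W t w.

Definition drawdown {d : measure_display} {T : measurableType d} {R : realType}
    {P : probability T R} (W : R -> {RV P >-> R}) (eta theta sigma b z : R)
    (t : R) (w : T) : R :=
  let X := surplus W eta theta sigma b in
  Num.max z (sup [set X s w | s in `[0, t]]) - X t w.

Definition has_density {R : realType} (nu : set R -> \bar R) (f : R -> R) :
    Prop :=
  [/\ measurable_fun [set: R] f, forall x, 0 <= f x &
      forall A : set R, measurable A ->
        nu A = (\int[lebesgue_measure]_(x in A) (f x)%:E)%E].

(* Main.v *)
(* Seen backwards from time [t], the path [Y_s = X_(t-s) - X_t] is a Brownian
   motion with drift [- m] and volatility [v], and the drawdown is at most [a]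
   exactly when [Y] stays below [a] up to time [t] and ends below [a - z].  The
   probability of this event comes from the method of images: to the indicator
   of ]-oo, a - z] one subtracts the indicator of [a + z, +oo[ weighted by
   exp (2 m (y - a) / v^2), so that the expected value at time [t] of the
   difference, as a function of the starting point and the remaining time,
   vanishes on the barrier [a].  On a grid, the independence of the increments
   gives the Markov property at the first grid time where [Y] exceeds [a]; the
   overshoot there disappears as the mesh tends to 0 because the paths are
   uniformly continuous on [0, t].  Neither Girsanov's theorem nor the strong
   Markov property is needed.  The density is the derivative of the distribution
   function, and is nonnegative because the latter is nondecreasing. *)

From HB Require Import structures.
Require Import Defs.
From mathcomp Require Import all_boot all_order all_algebra.
From mathcomp Require Import all_classical all_reals all_analysis.
From mathcomp Require Import measurable_realfun ring lra zify.

Set Implicit Arguments.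
Unset Strict Implicit.
Unset Printing Implicit Defensive.

Import Order.TTheory GRing.Theory Num.Theory.
Import numFieldNormedType.Exports.

Local Open Scope classical_set_scope.
Local Open Scope ring_scope.

(** * Gaussian integrals *)

Section density.
Local Open Scope ereal_scope.
Import HBNNSimple.
Context d (T : measurableType d) (R : realType).
Variables (mu nu : {measure set T -> \bar R}) (p : T -> R).
Hypotheses (mp : measurable_fun setT p) (p0 : forall x, (0 <= p x)%R).
Hypothesis nuE : forall A, measurable A -> nu A = \int[mu]_(x in A) (p x)%:E.

(** Monotone convergence along the simple approximations [g n] reduces the claim to simple
    functions, and linearity to indicators of level sets, where it is [nuE]. *)
Lemma ge0_integral_density (f : T -> \bar R) :
  measurable_fun setT f -> (forall x, 0 <= f x) ->
  \int[nu]_x f x = \int[mu]_x (f x * (p x)%:E).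
Proof.
move=> mf f0; pose g := nnsfun_approx measurableT mf.
have g_cvg x : (g n x)%:E @[n --> \oo] --> f x.
  by apply: cvg_nnsfun_approx => //.
transitivity (limn (fun n => \int[nu]_x (g n x)%:E)).
  rewrite -monotone_convergence//.
  - by apply: eq_integral => x _; apply/esym/cvg_lim.
  - by move=> n; exact/measurable_EFinP/measurable_funP.
  - by move=> n y _; rewrite lee_fin.
  - by move=> y _ m n mn; rewrite lee_fin; exact/lefP/nd_nnsfun_approx.
rewrite [X in limn X](_ : _ = (fun n => \int[mu]_x ((g n x)%:E * (p x)%:E))).
  rewrite -monotone_convergence//; last 3 first.
  - move=> n /=; apply: emeasurable_funM; apply/measurable_EFinP => //.
  - by move=> n x _; rewrite mule_ge0// lee_fin.
  - move=> x _ m n mn; rewrite lee_wpmul2r ?lee_fin//.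
    exact/lefP/nd_nnsfun_approx.
  apply: eq_integral => x _; apply/cvg_lim => //.
  by apply: cvgeZr => //; exact: g_cvg.
apply/funext => n.
transitivity (\sum_(k \in range (g n))
    \int[nu]_x (k * \1_(g n @^-1` [set k]) x)%:E).
  under eq_integral do rewrite fimfunE -fsumEFin//.
  rewrite ge0_integral_fsum//.
  - by move=> y; exact/measurable_EFinP/measurable_funM.
  - by move=> y x _; rewrite nnfun_muleindic_ge0.
transitivity (\sum_(k \in range (g n))
    \int[mu]_x ((k * \1_(g n @^-1` [set k]) x)%:E * (p x)%:E)); last first.
  rewrite -ge0_integral_fsum//; last 2 first.
  - move=> y; apply: emeasurable_funM; apply/measurable_EFinP => //.
    exact/measurable_funM.
  - by move=> y x _; rewrite mule_ge0 ?(EFinM, nnfun_muleindic_ge0, lee_fin).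
  apply: eq_integral => x _.
  rewrite fimfunE -fsumEFin// ge0_mule_fsuml// => i.
  exact: nnfun_muleindic_ge0.
apply: eq_fsbigr => r _; rewrite integralZl_indic_nnsfun// integral_indic//= setIT.
under eq_integral => x _ do rewrite EFinM -muleA.
(* Only a nonnegative scalar can be pulled out of the integral below; a negative level has an empty
   preimage. *)
have [r0|r0] := ltP r 0%R.
  rewrite preimage_nnfun0// measure0 mule0.
  by rewrite integral0_eq// => x _; rewrite indicE in_set0 mul0e mule0.
rewrite ge0_integralZl_EFin//.
- rewrite nuE// integral_mkcond; congr (_ * _); apply: eq_integral => x _.
  by rewrite patchE indicE; case: (x \in _); rewrite ?mul1e ?mul0e.
- by move=> x _; rewrite mule_ge0 ?lee_fin.
- by apply: emeasurable_funM; apply/measurable_EFinP.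
Qed.

End density.

Section gauss.
Context {R : realType}.
Implicit Types (s k x y : R).
Local Notation mu := (@lebesgue_measure R).

Lemma normal_pdf_scale s x : 0 < s ->
  normal_pdf 0 s x = normal_pdf 0 1 (x / s) / s.
Proof.
move=> s0; have sn0 : s != 0 by rewrite gt_eqF.
rewrite !normal_pdfE ?oner_neq0// /normal_peak /normal_fun !subr0 expr1n mul1r.
rewrite -mulrnAr sqrtrM ?sqr_ge0// sqrtr_sqr gtr0_norm// invfM.
rewrite (_ : - x ^+ 2 / (s ^+ 2 *+ 2) = - (x / s) ^+ 2 / (1 *+ 2)); last by field.
by ring.
Qed.

Lemma PhiE x : (Phi x)%:E = normal_prob 0 1 `]-oo, x].
Proof. by rewrite /Phi fineK// fin_num_measure. Qed.

Lemma Phi_ge0 x : 0 <= Phi x.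
Proof. by rewrite -lee_fin PhiE. Qed.

Lemma Phi_le1 x : Phi x <= 1.
Proof. by rewrite -lee_fin PhiE probability_le1. Qed.

Lemma is_derive_Phi x : is_derive x 1 (@Phi R) (normal_pdf 0 1 x).
Proof.
have i1 : mu.-integrable `]-oo, x + 1] (EFin \o normal_pdf 0 1).
  by apply: (integrableS measurableT) => //; exact: integrable_normal_pdf.
have c1 : {for x, continuous (@normal_pdf R 0 1)}.
  by apply: continuous_normal_pdf; rewrite oner_neq0.
have xx1 : x < x + 1 by rewrite ltrDl.
have := continuous_FTC1 xx1 i1.  move=> /(_ (ltNyr x) c1)/= -[dF F'E].
have e : (fun y => (\int[mu]_(t in `]-oo, y]) normal_pdf 0 1 t)%R) = @Phi R by [].
rewrite e in dF F'E; apply: (@DeriveDef _ _ _ _ _ _ _ dF).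
by rewrite -derive1E.
Qed.

(** Substitution of the increasing affine map [F x = (x + k) / s], whose constant derivative is the
    factor in [normal_pdf_scale]. *)
Lemma integral_normal_pdf_shift s k y : 0 < s ->
  (\int[mu]_(x in `]-oo, y]) (normal_pdf 0 s (x + k))%:E =
   (Phi ((y + k) / s))%:E)%E.
Proof.
move=> s0; rewrite PhiE /normal_prob.
pose F x : R := (x + k) / s.
have dF x : is_derive x 1 F s^-1.
  rewrite /F; apply: is_derive_eq; rewrite scaler0 add0r addr0.
  by rewrite /GRing.scale/= mulr1.
have F'E : F^`()%classic = cst s^-1.
  by apply/funext => x; rewrite derive1E derive_val.
rewrite -/(F y) (@increasing_ge0_integration_by_substitutionNy R F _ y).
- apply: eq_integral => x _; rewrite F'E !fctE/= /F.
  by rewrite -normal_pdf_scale.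
- by move=> a b _ _ ab; rewrite /F ltr_pM2r ?invr_gt0// ltrD2r.
- by rewrite F'E => ? _; exact: cvg_cst.
- by rewrite F'E; exact: is_cvg_cst.
- by rewrite F'E; exact: cvg_cst.
- split; first by move=> x _.
  apply: cvg_at_left_filter; apply/differentiable_continuous.
  by apply/derivable1_diffP.
- apply/gt0_cvgMlNy; first by rewrite invr_gt0.
  exact: cvg_addrr_Ny.
- apply: continuous_subspaceT; apply: continuous_normal_pdf.
  by rewrite oner_neq0.
- by move=> x _; exact: normal_pdf_ge0.
Qed.

Lemma normal_prob_NycE s y : 0 < s ->
  normal_prob 0 s `]-oo, y] = (Phi (y / s))%:E.
Proof.
move=> s0; have := integral_normal_pdf_shift 0 y s0; rewrite addr0 => <-.
by apply: eq_integral => x _; rewrite addr0.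
Qed.

Lemma normal_prob_cyE s y : 0 < s ->
  normal_prob 0 s `[y, +oo[ = (Phi (- y / s))%:E.
Proof.
move=> s0; rewrite -normal_prob_NycE// /normal_prob.
rewrite ge0_integration_by_substitutionNy.
- apply: eq_integral => x _; congr EFin => /=.
  by rewrite !normal_pdfE ?gt_eqF// /normal_fun !subr0 sqrrN.
- apply: continuous_subspaceT; apply: continuous_normal_pdf.
  by rewrite gt_eqF.
- by move=> x _; exact: normal_pdf_ge0.
Qed.

Lemma Phi_le : {homo @Phi R : x y / x <= y}.
Proof.
move=> x y xy; rewrite -lee_fin !PhiE le_measure ?inE//.
by move=> u /=; rewrite !in_itv/= => /le_trans; exact.
Qed.

(** Mean value theorem: the derivative is at most its peak, the inverse of the square root of
    [2 pi], which is below 1. *)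
Lemma Phi_dist_le x y : `|Phi x - Phi y| <= `|x - y|.
Proof.
wlog xy : x y / x <= y.
  move=> H; have [/H//|/ltW yx] := leP x y.
  by rewrite distrC [leRHS]distrC H.
rewrite distrC [leRHS]distrC.
have [||c _ ->] := @MVT_segment R Phi (normal_pdf 0 1) x y xy.
- by move=> u _; exact: is_derive_Phi.
- apply: derivable_within_continuous => u _.
  by apply: ex_derive; exact: is_derive_Phi.
rewrite normrM ler_piMl// ger0_norm ?normal_pdf_ge0//.
rewrite (le_trans (normal_pdf_ub _ _ _)) ?oner_neq0//.
rewrite /normal_peak expr1n mul1r invf_le1 ?sqrtr_gt0.
  rewrite -[leLHS]sqrtr1 ler_sqrt; have := pi_ge2 R; lra.
by have := pi_ge2 R; lra.
Qed.

(** [Phi] is the distribution function of the identity on the line equipped with the standard normal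
    law. *)
Lemma Phi_cvg_Ny : Phi x @[x --> -oo] --> (0 : R).
Proof.
pose N01 : probability (measurableTypeR R) R := normal_prob 0 1.
pose f : measurableTypeR R -> R := idfun.
have mf : measurable_fun setT f by exact: measurable_id.
pose X : {RV N01 >-> R} := mfun_Sub (mem_set mf).
have /fine_cvgP[_] := cvg_cdfNy0 X.
by apply: cvg_trans; apply: near_eq_cvg; apply: nearW.
Qed.


(** Completing the square: the weight [expR (c * x)] shifts the mean of the Gaussian density to
    [c * s ^+ 2] and leaves the constant [expR (c ^+ 2 * s ^+ 2 / 2)]. *)
Lemma integral_normal_expR s c y : 0 < s ->
  (\int[normal_prob 0 s]_x ((expR (c * x) * \1_`]-oo, y] x)%:E) =
   (expR (c ^+ 2 * s ^+ 2 / 2) * Phi ((y - c * s ^+ 2) / s))%:E)%E.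
Proof.
move=> s0; have sn0 : s != 0 by rewrite gt_eqF.
have mexp : measurable_fun setT (fun x : R => expR (c * x)).
  by apply: measurableT_comp => //; exact: measurable_funM.
rewrite (ge0_integral_density (mu := mu) (p := normal_pdf 0 s)); first last.
- by move=> x; rewrite lee_fin mulr_ge0// expR_ge0.
- by apply/measurable_EFinP; exact: measurable_funM.
- by [].
- by move=> x; exact: normal_pdf_ge0.
- exact: measurable_normal_pdf.
have mshift : measurable_fun `]-oo, y]
    (fun x => (normal_pdf 0 s (x - c * s ^+ 2))%:E).
  apply/measurable_EFinP; apply: measurableT_comp.
    exact: measurable_normal_pdf.
  by apply: measurable_funTS; apply: measurable_funD => //; exact: measurable_cst.
have shift0 x : `]-oo, y]%classic x ->
    (0 <= (normal_pdf 0 s (x - c * s ^+ 2))%:E)%E.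
  by move=> _; rewrite lee_fin normal_pdf_ge0.
rewrite EFinM -(integral_normal_pdf_shift _ _ s0).
have := ge0_integralZl_EFin mu (measurable_itv `]-oo, y]) shift0 mshift
  (expR_ge0 (c ^+ 2 * s ^+ 2 / 2)).
move=> /esym ->.
rewrite [RHS]integral_mkcond; apply: eq_integral => x _; rewrite patchE indicE.
case: ifPn => _; last by rewrite mulr0 mul0e.
rewrite mulr1 -!EFinM; congr EFin; rewrite !normal_pdfE// /normal_fun.
rewrite mulrCA [RHS]mulrCA -!expRD; congr (_ * expR _).
by field.
Qed.

End gauss.

(** * Integration against an independent variable *)

Section independence.
Local Open Scope ereal_scope.
Context d (T : measurableType d) (R : realType) (P : probability T R).
Variables (G : set (set T)) (U : {RV P >-> R}).
Hypotheses (GI : setI_closed G) (Gm : G `<=` measurable) (GT : G setT).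
Hypothesis indep : forall A B, G A -> measurable B ->
  P (A `&` U @^-1` B) = P A * P (U @^-1` B).

Local Notation TG := (g_sigma_algebraType G).

Lemma sub_salgebra_measurable A : <<s G >> A -> d.-measurable A.
Proof. exact: (smallest_sub (@sigma_algebra_measurable _ T) Gm). Qed.

(** For fixed [B] both sides are finite measures in [A]. They agree on [G], which is closed under
    intersection and contains the whole space, hence on the sigma-algebra it generates. *)
Lemma indep_salgebra A B : <<s G >> A -> measurable B ->
  P (A `&` U @^-1` B) = P A * P (U @^-1` B).
Proof.
move=> GA mB.
have mUB : measurable (U @^-1` B).
  by rewrite -[X in measurable X]setTI; exact: measurable_funPT.
have k0 : (0 <= fine (P (U @^-1` B)))%R by exact: fine_ge0.
pose m1 := mrestr P mUB.
pose m2 := mscale (NngNum k0) P.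
have m2E C : m2 C = P C * P (U @^-1` B).
  by rewrite /m2 /mscale/= fineK ?fin_num_measure// muleC.
rewrite -m2E.
apply: (@g_sigma_algebra_measure_unique _ _ _ G Gm (fun=> setT) _ _ m1 m2) => //.
- by apply: bigcup_const.
- by move=> C GC; rewrite /m1/= /mrestr indep//; exact/esym/m2E.
- move=> _; change (P (setT `&` U @^-1` B) < +oo).
  by rewrite setTI (le_lt_trans (probability_le1 _ _)) ?ltry.
Qed.

(** Independence makes the law of [(w, U w)] a product once [w] is read in the coarser space [TG];
    Tonelli then integrates [U] out with [w] frozen. This takes the place of conditioning on the
    past. *)
Lemma indep_fubini (f : TG * R -> \bar R) :
  measurable_fun setT f -> (forall x, 0 <= f x) ->
  \int[P]_w f (w, U w) = \int[P]_w \int[distribution P U]_u f (w, u).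
Proof.
move=> mf f0.
have mid : measurable_fun setT (idfun : T -> TG).
  by move=> _ A GA; rewrite setTI; exact: sub_salgebra_measurable.
pose iG : {mfun T >-> TG} := HB.pack (idfun : T -> TG)
  (isMeasurableFun.Build _ _ T TG (idfun : T -> TG) mid).
have mU : measurable_fun setT U by [].
have miU : measurable_fun setT (fun w => (iG w, U w)).
  by apply/measurable_fun_pairP; split.
pose iU : {mfun T >-> (TG * R)%type} := HB.pack (fun w => (iG w, U w))
  (isMeasurableFun.Build _ _ T (TG * R)%type (fun w => (iG w, U w)) miU).
transitivity (\int[distribution P iU]_z f z).
  by rewrite ge0_integral_distribution.
rewrite (eq_measure_integral (distribution P iG \x distribution P U)); last first.
  move=> A mA _; apply/esym; apply: product_measure_unique => // B C mB mC.
  exact: indep_salgebra.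
rewrite fubini_tonelli1// ge0_integral_distribution//.
- exact: measurable_fun_fubini_tonelli_F.
- by move=> w; apply: integral_ge0.
Qed.

End independence.

(** * The Markov property on a grid *)

Section measurableTypeR.
Local Open Scope ereal_scope.

(* [R] and [measurableTypeR R] have the same measurable sets but distinct
   displays; random variables take values in the former, while [normal_prob]
   is a measure on the latter. *)
Lemma ge0_integral_measurableTypeR (R : realType)
    (mu : {measure set R -> \bar R})
    (nu : {measure set (measurableTypeR R) -> \bar R}) (f : R -> \bar R) :
  (forall A : set R, measurable A -> mu A = nu A) ->
  measurable_fun [set: R] f -> (forall x, 0 <= f x) ->
  \int[mu]_x f x = \int[nu]_x f x.
Proof.
move=> munu mf f0.
have mid : measurable_fun setT (idfun : measurableTypeR R -> R).
  by move=> _ A mA; rewrite setTI.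
have := ge0_integral_pushforward mid nu measurableT mf (fun x _ => f0 x).
move=> <-.
by apply: eq_measure_integral => A mA _; exact: munu.
Qed.

End measurableTypeR.

Section grid.
Context d (T : measurableType d) (R : realType) (P : probability T R).
Variables (W : R -> {RV P >-> R}) (hW : brownian_motion W).
Variables (m v h : R) (N : nat).
Hypothesis h0 : 0 < h.

Let X s w := m * s + v * W s w.

Definition reversed_path j w : R := X ((N - j)%N%:R * h) w - X (N%:R * h) w.
Local Notation Y := reversed_path.

(** The bound [a + e] keeps only first passages with a small overshoot, where the two potentials are
    close; the others are collected in [overshoot]. *)
Definition first_exceed (a e : R) k : set T :=
  [set w | (forall j, (j < k)%N -> Y j w <= a) /\ a < Y k w <= a + e].

Lemma reversed_path_measurable j : measurable_fun setT (Y j).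
Proof.
by apply: measurable_funB; apply: measurable_funD => //; apply: measurable_funM.
Qed.

(** This form yields measurability both in [T] and in the smaller sigma-algebra generated by the
    first [k] steps. *)
Lemma first_exceedE a e k : first_exceed a e k =
  (\bigcap_(j < k) (Y j @^-1` `]-oo, a])) `&` (Y k @^-1` `]a, a + e]).
Proof.
apply/seteqP; split => w /=; rewrite !in_itv/=.
  by move=> [H1 H2]; split => // j /= jk; rewrite in_itv/=; exact: H1.
by move=> [H1 H2]; split => // j jk; have := H1 j jk; rewrite /= in_itv.
Qed.

Lemma first_exceed_measurable a e k : measurable (first_exceed a e k).
Proof.
rewrite first_exceedE; apply: measurableI.
  apply: bigcap_measurableType => // j jk.
  by rewrite -[_ @^-1` _]setTI; exact: reversed_path_measurable.
by rewrite -[_ @^-1` _]setTI; exact: reversed_path_measurable.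
Qed.

Lemma first_exceed_trivIset a e : trivIset setT (first_exceed a e).
Proof.
apply/trivIsetP => i j _ _; wlog ij : i j / (i < j)%N.
  move=> H; rewrite neq_ltn => /orP[] ij; first by apply: H => //; rewrite ltn_eqF.
  by rewrite setIC; apply: H => //; rewrite ltn_eqF.
move=> _; apply/seteqP; split => // w [[_ /andP[aYi _]] [/(_ i ij)]].
by rewrite leNgt aYi.
Qed.

Section step.
Variable k : nat.
Hypothesis kN : (k < N)%N.

(** The times 0, (N - k) h, (N - k + 1) h, ..., N h. Increment 0 spans the remaining time in one
    block; increments 1 to [k] are the single grid steps that build [Y 1], ..., [Y k]. *)
Let s i : R := (if i is i'.+1 then (N - k + i')%N else 0%N)%:R * h.

Let s_incr i : s i < s i.+1.
Proof.
rewrite /s ltr_pM2r// ltr_nat; case: i => [|i]; last by rewrite addnS.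
by rewrite addn0 subn_gt0.
Qed.

Let U : {RV P >-> R} := W (s 1) \- W (s 0).

Let I (i : 'I_k.+1) : {RV P >-> R} := W (s i.+1) \- W (s i).

(* [B ord0 = setT] leaves out [U], the increment over the time that remains
   once [Y] has run for [k] steps. *)
Let G : set (set T) := [set E | exists B : 'I_k.+1 -> set R,
  [/\ forall i, measurable (B i), B ord0 = setT &
      E = [set w | forall i, B i (I i w)]]].

Let G_setI_closed : setI_closed G.
Proof.
move=> _ _ [B [mB B0 ->]] [C [mC C0 ->]]; exists (fun i => B i `&` C i); split.
- by move=> i; exact: measurableI.
- by rewrite B0 C0 setTI.
- apply/seteqP; split => w /=.
    by move=> [Bw Cw] i; split; [exact: Bw|exact: Cw].
  by move=> BC; split => i; case: (BC i).
Qed.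

Let G_measurable : G `<=` measurable.
Proof.
move=> _ [B [mB _ ->]].
rewrite (_ : mkset _ = \bigcap_(i in [set: 'I_k.+1]) (I i @^-1` B i)).
  apply: fin_bigcap_measurable => // i _.
  by rewrite -[X in measurable X]setTI; exact: measurable_funPT.
by apply/seteqP; split => w /=; [move=> H i _; exact: H|move=> H i; exact: H].
Qed.

Let G_setT : G setT.
Proof.
exists (fun=> setT); split => //.
by apply/seteqP; split.
Qed.

Let mindep : mutually_independent I.
Proof.
apply: (bm_indep hW); first by rewrite /s mul0r.
by move=> i _; exact: s_incr.
Qed.

Let G_indep A B : G A -> measurable B ->
  (P (A `&` U @^-1` B) = P A * P (U @^-1` B))%E.
Proof.
move=> [C [mC C0 ->]] mB.
(* Slot 0 of an event of [G] is free, so it can host the condition on [U]; the product rule is then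
   applied with and without it. *)
pose C' i := if i == ord0 then B else C i.
have mC' i : measurable (C' i) by rewrite /C'; case: ifP.
rewrite mindep// (_ : _ `&` _ = [set w | forall i, C' i (I i w)]); last first.
  apply/seteqP; split => w /=.
    by move=> [Cw Bw] i; rewrite /C'; case: eqVneq => [->//|_]; exact: Cw.
  move=> C'w; split; last by have := C'w ord0; rewrite /C' eqxx.
  move=> i; have := C'w i; rewrite /C'; case: eqVneq => // -> _.
  by rewrite C0.
rewrite mindep// !big_ord_recl C0 preimage_setT probability_setT mul1e muleC.
by congr (_ * _)%E.
Qed.

Local Notation TG := (g_sigma_algebraType G).

Let mI i : i != ord0 -> measurable_fun [set: TG] (I i).
Proof.
move=> i0 _ B mB; rewrite setTI; apply: sub_sigma_algebra.
exists (fun j => if j == i then B else setT); split.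
- by move=> j; case: ifP.
- by rewrite eq_sym (negbTE i0).
- apply/seteqP; split => w /=.
    by move=> Bw j; case: eqVneq => // ->.
  by move=> /(_ i); rewrite eqxx.
Qed.

(** Passing from [Y j] to [Y j.+1] consumes the increment of index [k - j], which is nonzero for
    [j < k]; hence [U] never enters. *)
Let mY j : (j <= k)%N -> measurable_fun [set: TG] (Y j).
Proof.
elim: j => [_|j IH jk].
  rewrite (_ : Y 0 = cst 0); first exact: measurable_cst.
  by apply/funext => w; rewrite /reversed_path subn0 subrr.
have kj : (k - j < k.+1)%N by rewrite ltnS leq_subr.
pose i : 'I_k.+1 := Ordinal kj.
rewrite (_ : Y j.+1 = (fun w => Y j w - (m * h + v * I i w))); last first.
  apply/funext => w; rewrite /reversed_path /X /I /= /s.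
  have [i' ii'] : exists i', (k - j)%N = i'.+1.
    by exists (k - j.+1)%N; rewrite -subSn.
  rewrite ii' (_ : N - k + i'.+1 = N - j)%N; last by lia.
  rewrite (_ : N - k + i' = N - j.+1)%N; last by lia.
  rewrite (_ : (N - j)%N = (N - j.+1).+1); last by lia.
  by rewrite -natr1; ring.
apply: measurable_funB; first exact: (IH (ltnW jk)).
apply: measurable_funD; first exact: measurable_cst.
apply: measurable_funM; first exact: measurable_cst.
by apply: mI; rewrite -val_eqE/= subn_eq0 -ltnNge.
Qed.

Let mE a e : <<s G >> (first_exceed a e k).
Proof.
rewrite first_exceedE; apply: (@measurableI _ TG).
  apply: (@bigcap_measurableType _ TG) => // j jk.
  by rewrite -[_ @^-1` _]setTI; apply: mY => //; exact: ltnW.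
by rewrite -[_ @^-1` _]setTI; apply: mY.
Qed.

(** The Markov property at step [k]: with s = (N - k) h, [Y N] equals [Y k - m * s - v * U], where
    [U] is centred Gaussian of variance s and independent of the event and of [Y k]. *)
Lemma first_exceed_fubini (a e : R) (f : R -> \bar R) :
  measurable_fun setT f -> (forall x, 0 <= f x)%E ->
  (\int[P]_(w in first_exceed a e k) f (Y N w) =
   \int[P]_(w in first_exceed a e k)
     \int[normal_prob 0 (Num.sqrt ((N - k)%N%:R * h))]_u
        f (Y k w - m * ((N - k)%N%:R * h) - v * u)%R)%E.
Proof.
move=> mf f0.
pose g (z : TG * R) : \bar R := ((\1_(first_exceed a e k) z.1)%:E *
  f (Y k z.1 - m * ((N - k)%N%:R * h) - v * z.2)%R)%E.
have m1E : measurable_fun [set: TG] (\1_(first_exceed a e k) : TG -> R).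
  by apply: measurable_indic; exact: mE.
have mg : measurable_fun setT g.
  apply: emeasurable_funM.
    by apply/measurable_EFinP; exact: (measurableT_comp m1E measurable_fst).
  apply: measurableT_comp => //; apply: measurable_funB.
    apply: measurable_funB; last exact: measurable_cst.
    exact: (measurableT_comp (mY (leqnn k)) measurable_fst).
  by apply: measurable_funM => //; exact: measurable_snd.
have g0 z : (0 <= g z)%E by rewrite mule_ge0// lee_fin.
have := indep_fubini G_setI_closed G_measurable G_setT G_indep mg g0.
rewrite /g/= => fub.
rewrite integral_mkcond [RHS]integral_mkcond.
transitivity (\int[P]_w g (w, U w))%E.
  apply: eq_integral => w _; rewrite patchE /g/= indicE.
  case: ifP => _; last by rewrite mul0e.
  rewrite mul1e; congr f; rewrite /reversed_path subnn /U/= /X /s addn0.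
  rewrite mulr0n mul0r mulr0. ring.
rewrite fub; apply: eq_integral => w _; rewrite patchE indicE.
case: ifP => _; last by rewrite integral0_eq// => u _; rewrite mul0e.
under eq_integral do rewrite mul1e.
apply: ge0_integral_measurableTypeR => [A mA||u]; last first.
- exact: f0.
- apply: measurableT_comp => //; apply: measurable_funB; first exact: measurable_cst.
  exact: measurable_funM.
have s00 : s 0 = 0 by rewrite /s mul0r.
have s10 : s 1 - s 0 = (N - k)%N%:R * h by rewrite s00 subr0 /s addn0.
have s0_ge0 : 0 <= s 0 by rewrite s00.
by have := bm_gauss hW s0_ge0 (s_incr 0) mA; rewrite s10.
Qed.

End step.
End grid.

(** * The method of images *)

Section method_of_images.
Context {R : realType}.
Variables (m v a z : R).
Hypothesis v0 : 0 < v.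

Definition target (y : R) : R := \1_`]-oo, a - z] y.

(* The method of images for a drifted Brownian motion: the source at the
   mirror image of the target half-line carries an exponential weight, chosen
   so that the two potentials below cancel on the barrier [a]. *)
Definition mirror (y : R) : R :=
  expR (2 * m / v ^+ 2 * (y - a)) * \1_`[a + z, +oo[ y.

(** This and [mirror_potential] are the expected final values of [target] and [mirror] from [x] with
    time [s] left. At [x = a] both reduce to [Phi ((m * s - z) / (Num.sqrt s * v))]. *)
Definition target_potential (s x : R) : R :=
  Phi ((a - z - x + m * s) / (Num.sqrt s * v)).

Definition mirror_potential (s x : R) : R :=
  expR (2 * m / v ^+ 2 * (x - a)) *
  Phi ((x - a - z + m * s) / (Num.sqrt s * v)).

Lemma target_ge0 y : 0 <= target y. Proof. by []. Qed.

Lemma mirror_ge0 y : 0 <= mirror y. Proof. by rewrite mulr_ge0// expR_ge0. Qed.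

Lemma measurable_target : measurable_fun setT target.
Proof. exact: measurable_indic. Qed.

Lemma measurable_mirror : measurable_fun setT mirror.
Proof.
apply: measurable_funM; last exact: measurable_indic.
by apply: measurableT_comp => //; apply: measurable_funM => //; exact: measurable_funB.
Qed.

Lemma target_potentialE s x : 0 < s ->
  (\int[normal_prob 0 (Num.sqrt s)]_u (target (x - m * s - v * u))%:E =
   (target_potential s x)%:E)%E.
Proof.
move=> s0; have ss0 : 0 < Num.sqrt s by rewrite sqrtr_gt0.
transitivity (\int[normal_prob 0 (Num.sqrt s)]_u
    (\1_`[(x - m * s - (a - z)) / v, +oo[ u)%:E)%E.
  apply: eq_integral => u _; rewrite /target !indicE; congr (_%:R%:E).
  congr nat_of_bool; apply/idP/idP; rewrite !inE/= !in_itv/= andbT.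
    by move=> H; rewrite ler_pdivrMr//; lra.
  by rewrite ler_pdivrMr// => H; lra.
rewrite integral_indic//= setIT normal_prob_cyE//; congr (Phi _)%:E.
by field; rewrite !gt_eqF.
Qed.

(** With [c = 2 * m / v ^+ 2], the Gaussian shift caused by the weight turns [- m * s] into
    [+ m * s] in the argument of [Phi], and its constant cancels the term [- c * m * s] of the
    exponent. *)
Lemma mirror_potentialE s x : 0 < s ->
  (\int[normal_prob 0 (Num.sqrt s)]_u (mirror (x - m * s - v * u))%:E =
   (mirror_potential s x)%:E)%E.
Proof.
move=> s0; have ss0 : 0 < Num.sqrt s by rewrite sqrtr_gt0.
have vn0 : v != 0 by rewrite gt_eqF.
set c := 2 * m / v ^+ 2.
transitivity (\int[normal_prob 0 (Num.sqrt s)]_u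
    ((expR (c * (x - m * s - a)))%:E *
     (expR ((- (c * v)) * u) * \1_`]-oo, ((x - m * s - (a + z)) / v)] u)%:E))%E.
  apply: eq_integral => u _; rewrite /mirror -EFinM mulrA -expRD.
  congr (expR _ * _)%:E.
    by rewrite /c; ring.
  rewrite !indicE; congr (_%:R).
  congr nat_of_bool; apply/idP/idP; rewrite !inE/= !in_itv/= andbT.
    by move=> H; rewrite ler_pdivlMr//; lra.
  by rewrite ler_pdivlMr// => H; lra.
rewrite ge0_integralZl_EFin//; last first.
- apply/measurable_EFinP; apply: measurable_funM; last exact: measurable_indic.
  by apply: measurableT_comp => //; exact: measurable_funM.
rewrite integral_normal_expR// -EFinM mulrA -expRD sqr_sqrtr ?ltW//.
congr (expR _ * Phi _)%:E; rewrite /c; first by field.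
by field; rewrite vn0 gt_eqF.
Qed.

Lemma measurable_Phi : measurable_fun setT (@Phi R).
Proof. by apply: nondecreasing_measurable => // x y xy; exact: Phi_le. Qed.

Lemma measurable_target_potential s : measurable_fun setT (target_potential s).
Proof.
apply: (measurableT_comp measurable_Phi); apply: measurable_funM => //.
by apply: measurable_funD => //; exact: measurable_funB.
Qed.

Lemma measurable_mirror_potential s : measurable_fun setT (mirror_potential s).
Proof.
apply: measurable_funM.
  by apply: measurableT_comp => //; apply: measurable_funM => //; exact: measurable_funB.
apply: (measurableT_comp measurable_Phi); apply: measurable_funM => //.
by apply: measurable_funD => //; apply: measurable_funB => //; exact: measurable_funB.
Qed.

(* Near the barrier the two potentials differ little, uniformly in time:
   both are small for small [s], and for the other [s] they are Lipschitz. *)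
Lemma potential_gap t eta : 0 < z -> 0 < t -> 0 < eta -> exists2 e,
  0 < e < z & forall s x, 0 < s <= t -> a < x <= a + e ->
  `|target_potential s x - mirror_potential s x| <= eta.
Proof.
move=> z0 t0 eta0.
have [K KP] : exists K : R, Phi (- K) <= eta / 4.
  have [M [_ MP]] : \forall x \near -oo, Phi x < eta / 4.
    by apply: (cvgr_lt (0:R)); [exact: Phi_cvg_Ny|lra].
  exists (- (M - 1)); rewrite opprK ltW// MP//; lra.
have [e1 e10 e1P] : exists2 e1, 0 < e1 &
    forall u, 0 < u <= e1 -> `|1 - expR (2 * m / v ^+ 2 * u)| <= eta / 4.
  have c0 : {for 0, continuous (fun u : R => expR (2 * m / v ^+ 2 * u))}.
    apply: continuous_comp; last exact: continuous_expR.
    by apply: cvgM; [exact: cvg_cst|exact: cvg_id].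
  have e4 : 0 < eta / 4 by lra.
  move: c0 => /cvgrPdist_le/(_ _ e4); rewrite mulr0 expR0.
  move=> [e /= e_gt0 eP]; exists (e / 2); first lra.
  move=> u /andP[u0 ue]; apply: eP; rewrite /= sub0r normrN gtr0_norm//; lra.
pose K' := Num.max K 1.
have K'0 : 0 < K' by rewrite /K' lt_max ltr01 orbT.
have KK' : K <= K' by rewrite /K' le_max lexx.
have nm0 : 0 <= `|m| by [].
(* [r] separates small from large [Num.sqrt s]. Below it, [m * s] and [u] are each at most [z / 4],
   so the numerator of [B] is at most [- z / 2], hence at most [- K' * (r * v)], and [B <= - K]. *)
pose r := Num.min (Num.min 1 (z / (2 * v * K'))) (z / (4 * (`|m| + 1))).
have r0 : 0 < r by rewrite !lt_min ltr01 !divr_gt0 ?mulr_gt0//; lra.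
have r1 : r <= 1 by rewrite !ge_min lexx.
have r2 : r * (2 * v * K') <= z.
  by rewrite -ler_pdivlMr ?mulr_gt0// !ge_min lexx orbT.
have r3 : r * (4 * (`|m| + 1)) <= z.
  by rewrite -ler_pdivlMr ?mulr_gt0// !ge_min lexx !orbT.
(* The last bound serves [Num.sqrt s > r]: there [B - A = 2 * u / (Num.sqrt s * v)] is at most
   [eta / 2]. *)
pose e := Num.min (Num.min e1 (z / 4)) (eta * r * v / 8).
have e0 : 0 < e by rewrite !lt_min e10 !divr_gt0 ?mulr_gt0.
have ee1 : e <= e1 by rewrite !ge_min lexx.
have ez : e <= z / 4 by rewrite !ge_min lexx orbT.
have er : e <= eta * r * v / 8 by rewrite !ge_min lexx !orbT.
exists e; first by rewrite e0/=; lra.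
move=> s x /andP[s0 _] /andP[ax xae].
rewrite /target_potential /mirror_potential.
set u := x - a; have u0 : 0 < u by rewrite /u; lra.
have ue : u <= e by rewrite /u; lra.
rewrite (_ : a - z - x = - z - u); last by rewrite /u; ring.
rewrite (_ : u - z = - z + u); last by ring.
set A := (- z - u + m * s) / _; set B := (- z + u + m * s) / _.
have q0 : 0 < Num.sqrt s by rewrite sqrtr_gt0.
have qv0 : 0 < Num.sqrt s * v by rewrite mulr_gt0.
have AB : A <= B by rewrite ler_pM2r ?invr_gt0//; lra.
have gap : Phi B - Phi A <= eta / 2.
  have [qr|rq] := leP (Num.sqrt s) r.
    have BK : Phi B <= Phi (- K).
      apply: Phi_le; rewrite ler_pdivrMr//.
      have ms : m * s <= r * `|m|.
        rewrite (le_trans (ler_norm _))// normrM mulrC (gtr0_norm s0).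
        rewrite ler_wpM2r// (le_trans _ qr)//.
        have := sqr_sqrtr (ltW s0); rewrite expr2; nra.
      have sK : K * (Num.sqrt s * v) <= K' * (r * v).
        apply: (@le_trans _ _ (K' * (Num.sqrt s * v))).
          by rewrite ler_wpM2r// ltW.
        by apply: ler_wpM2l; [exact: ltW|apply: ler_wpM2r => //; exact: ltW].
      by nra.
    by have := Phi_ge0 A; lra.
  have := Phi_dist_le B A; rewrite (_ : B - A = 2 * u / (Num.sqrt s * v)); last first.
    by rewrite /A /B; field; rewrite !gt_eqF.
  have : `|2 * u / (Num.sqrt s * v)| <= eta / 2.
    have nng : 0 <= 2 * u / (Num.sqrt s * v) by apply: divr_ge0; lra.
    rewrite ger0_norm// ler_pdivrMr//.
    have : r * v <= Num.sqrt s * v by rewrite ler_pM2r// ltW.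
    by nra.
  have := ler_norm (Phi B - Phi A); lra.
(* The difference of the potentials is [Phi A - Phi B] plus
   [(1 - expR (2 * m / v ^+ 2 * u)) * Phi B]; this bounds the second term. *)
have exB : `|1 - expR (2 * m / v ^+ 2 * u)| * Phi B <= eta / 4.
  rewrite (le_trans _ (e1P u _)) ?u0 ?(le_trans ue)//.
  by rewrite ler_piMr// Phi_le1.
have := Phi_le AB.
move: exB; rewrite -[X in _ * X](@ger0_norm _ (Phi B)) ?Phi_ge0// -normrM.
rewrite !ler_norml; lra.
Qed.

End method_of_images.

(** * The barrier problem on a grid *)

Section barrier.
Context d (T : measurableType d) (R : realType) (P : probability T R).
Variables (W : R -> {RV P >-> R}) (hW : brownian_motion W).
Variables (m v a z : R) (h : R) (N : nat).
Hypotheses (v0 : 0 < v) (h0 : 0 < h) (N0 : (0 < N)%N).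

Local Notation Y := (reversed_path W m v h N).
Local Notation t := (N%:R * h).
Local Notation EY f D := (\int[P]_(w in D) (f (Y N w))%:E)%E.

Definition exceed e : set T :=
  \bigcup_(k in `I_N.+1) first_exceed W m v h N a e k.

Lemma exceed_measurable e : measurable (exceed e).
Proof.
by apply: fin_bigcup_measurable => // k _; exact: first_exceed_measurable.
Qed.

Let mY : measurable_fun setT (Y N). Proof. exact: reversed_path_measurable. Qed.

(** Split by the first passage step [k]. There [Y k] lies in []a, a + e]], and the Markov property
    replaces [f] and [g] by [F] and [G] at the remaining time; the disjoint events cost at most
    [eta] in total. It is applied with target and mirror in both orders. *)
Lemma integral_exceed_le (e eta : R) (f g : R -> R) (F G : R -> R -> R) :
  measurable_fun setT f -> measurable_fun setT g ->
  (forall s, measurable_fun setT (F s)) ->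
  (forall s, measurable_fun setT (G s)) ->
  (forall x, 0 <= f x) -> (forall x, 0 <= g x) ->
  (forall s x, 0 < s ->
    (\int[normal_prob 0 (Num.sqrt s)]_u (f (x - m * s - v * u))%:E =
     (F s x)%:E)%E) ->
  (forall s x, 0 < s ->
    (\int[normal_prob 0 (Num.sqrt s)]_u (g (x - m * s - v * u))%:E =
     (G s x)%:E)%E) ->
  0 <= eta ->
  (forall x, a < x <= a + e -> f x <= g x + eta) ->
  (forall s x, 0 < s <= t -> a < x <= a + e -> F s x <= G s x + eta) ->
  (EY f (exceed e) <= EY g (exceed e) + eta%:E)%E.
Proof.
move=> mf mg mF mG f0 g0 FE GE eta0 fg FG.
have G0 s x : 0 < s -> 0 <= G s x.
  move=> s0; rewrite -lee_fin -GE//; apply: integral_ge0 => u _.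
  by rewrite lee_fin; exact: g0.
have F0 s x : 0 < s -> 0 <= F s x.
  move=> s0; rewrite -lee_fin -FE//; apply: integral_ge0 => u _.
  by rewrite lee_fin; exact: f0.
have mfY : measurable_fun setT (fun w => f (Y N w)) by exact: measurableT_comp.
have mgY : measurable_fun setT (fun w => g (Y N w)) by exact: measurableT_comp.
have mexc k : measurable (first_exceed W m v h N a e k).
  exact: first_exceed_measurable.
have step k : (k < N.+1)%N ->
    (EY f (first_exceed W m v h N a e k) <=
     \int[P]_(w in first_exceed W m v h N a e k) (g (Y N w) + eta)%:E)%E.
  (* For [k = N] no time is left, so [f] and [g] themselves are compared. *)
  rewrite ltnS leq_eqVlt => /predU1P[->|kN].
    apply: ge0_le_integral => //.
    - by move=> w _; rewrite lee_fin.
    - by apply/measurable_EFinP; exact: measurable_funTS.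
    - apply/measurable_EFinP; apply: measurable_funTS; exact: measurable_funD.
    - by move=> w [_ Yw]; rewrite lee_fin fg.
  have s0 : 0 < (N - k)%N%:R * h by rewrite mulr_gt0// ltr0n subn_gt0.
  have st : (N - k)%N%:R * h <= t by rewrite ler_pM2r// ler_nat leq_subr.
  under [leRHS]eq_integral do rewrite EFinD.
  have mYk : measurable_fun setT (Y k) by exact: reversed_path_measurable.
  rewrite ge0_integralD//; first last.
  - by apply/measurable_EFinP; exact: measurable_funTS.
  - by move=> w _; rewrite lee_fin.
  have fub (u : R -> R) : measurable_fun setT u -> (forall x, 0 <= u x) -> _ :=
    fun mu u0 => first_exceed_fubini hW m v h0 kN a e
      ((measurable_EFinP _ _).2 mu) (fun x => u0 x : (0 <= (u x)%:E)%E).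
  rewrite (fub f)//= (fub g)//=.
  under eq_integral do rewrite FE//.
  under [X in (_ <= X + _)%E]eq_integral do rewrite GE//.
  rewrite -ge0_integralD//; first last.
  - by apply/measurable_EFinP; apply: measurable_funTS; exact: measurableT_comp.
  - by move=> w _; rewrite lee_fin G0.
  apply: ge0_le_integral => //.
  - by move=> w _; rewrite lee_fin F0.
  - by apply/measurable_EFinP; apply: measurable_funTS; exact: measurableT_comp.
  - apply/measurable_EFinP; apply: measurable_funTS.
    by apply: measurable_funD => //; exact: measurableT_comp.
  - by move=> w [_ Yw]; rewrite -EFinD lee_fin FG// s0.
have exceedE : exceed e =
    \big[setU/set0]_(k <- index_iota 0 N.+1) first_exceed W m v h N a e k.
  by rewrite big_mkord -bigcup_mkord.
have bigE (u : R -> R) : measurable_fun setT (fun w => u (Y N w)) ->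
    (forall x, 0 <= u x) ->
    (EY u (exceed e) = \sum_(k <- index_iota 0 N.+1)
      EY u (first_exceed W m v h N a e k))%E.
  move=> mu u0; rewrite exceedE ge0_integral_bigsetU//.
  - exact: iota_uniq.
  - exact: sub_trivIset (@first_exceed_trivIset _ _ _ _ _ _ _ _ _ _ _).
  - by apply/measurable_EFinP; exact: measurable_funTS.
  - by move=> x _; rewrite lee_fin.
apply: (@le_trans _ _ (\int[P]_(w in exceed e) (g (Y N w) + eta)%:E)%E).
  rewrite bigE// (bigE (fun x => g x + eta)).
  - rewrite big_nat [leRHS]big_nat; apply: lee_sum => k /andP[_ kN]; exact: step.
  - by apply: measurable_funD.
  - by move=> x; rewrite addr_ge0.
under eq_integral do rewrite EFinD.
rewrite ge0_integralD//; first last.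
- by apply/measurable_EFinP; exact: measurable_funTS.
- by move=> w _; rewrite lee_fin.
- exact: exceed_measurable.
rewrite leeD2l// integral_cst; last exact: exceed_measurable.
rewrite -[leRHS]mule1 lee_wpmul2l ?lee_fin// probability_le1//.
exact: exceed_measurable.
Qed.

Lemma integral_reversed_path (f : R -> R) (F : R -> R -> R) :
  measurable_fun setT f -> (forall x, 0 <= f x) ->
  (forall s x, 0 < s ->
    (\int[normal_prob 0 (Num.sqrt s)]_u (f (x - m * s - v * u))%:E =
     (F s x)%:E)%E) ->
  EY f setT = (F t 0)%:E.
Proof.
move=> mf f0 FE.
(* As [Y 0 = 0] lies in ]-1, 0], this event at time 0 is the whole space. *)
have Y0 w : Y 0 w = 0 by rewrite /reversed_path subn0 subrr.
have fT : first_exceed W m v h N (-1) 1 0 = setT.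
  apply/seteqP; split => // w _; split => //.
  by rewrite Y0 ltrN10 addNr lexx.
rewrite -fT (first_exceed_fubini hW m v h0 N0 (-1) 1
  ((measurable_EFinP _ _).2 mf) (fun x => f0 x : (0 <= (f x)%:E)%E))/= fT.
under eq_integral do rewrite Y0 subn0 FE ?mulr_gt0 ?ltr0n//.
by rewrite integral_cst// [X in (_ * X)%E]probability_setT mule1.
Qed.

Definition stay : set T := [set w | forall j, (j <= N)%N -> Y j w <= a].

(** The first grid value above [a] is already above [a + e]. *)
Definition overshoot e : set T := ~` (stay `|` exceed e).

Lemma stay_measurable : measurable stay.
Proof.
rewrite (_ : stay = \bigcap_(j in `I_N.+1) (Y j @^-1` `]-oo, a])).
  apply: fin_bigcap_measurable => // j _.
  by rewrite -[_ @^-1` _]setTI; exact: reversed_path_measurable.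
apply/seteqP; split => w H j; last by move=> jN; have := H j jN; rewrite /= in_itv.
by rewrite /= ltnS in_itv/=; exact: H.
Qed.

Lemma overshoot_measurable e : measurable (overshoot e).
Proof.
apply: measurableC; apply: measurableU; first exact: stay_measurable.
exact: exceed_measurable.
Qed.

Definition survive : set T := stay `&` [set w | Y N w <= a - z].

Lemma survive_measurable : measurable survive.
Proof.
apply: measurableI; first exact: stay_measurable.
by have := mY measurableT (measurable_itv `]-oo, a - z]); rewrite setTI.
Qed.

Let split3 (u : R -> R) e : measurable_fun setT u -> (forall x, 0 <= u x) ->
  (EY u setT = EY u stay + EY u (exceed e) + EY u (overshoot e))%E.
Proof.
move=> mu u0; rewrite -(setUv (stay `|` exceed e)).
have muY D : measurable_fun D (fun w => (u (Y N w))%:E).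
  by apply/measurable_EFinP; apply: measurable_funTS; exact: measurableT_comp.
have se : [disjoint stay & exceed e].
  apply/disj_setPS => w [Sw [k kN [_ /andP[aYk _]]]].
  by have := Sw k kN; rewrite leNgt aYk.
have mS := stay_measurable; have mE := exceed_measurable e.
have mO := overshoot_measurable e.
have mSE : measurable (stay `|` exceed e) by exact: measurableU.
have dO : [disjoint stay `|` exceed e & ~` (stay `|` exceed e)].
  by apply/disj_setPCl.
by rewrite !ge0_integral_setU// => x _; rewrite lee_fin.
Qed.

(** Split both expectations over [stay], [exceed e] and [overshoot e]. On [stay] the target
    contributes [P survive] and the mirror nothing; on [exceed e] the two agree up to [eta]; the
    overshoot terms remain as errors. *)
Lemma survive_estimate (e eta : R) : 0 < e < z -> 0 <= eta ->
  (forall s x, 0 < s <= t -> a < x <= a + e ->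
    `|target_potential m v a z s x - mirror_potential m v a z s x| <= eta) ->
  (P survive + (mirror_potential m v a z t 0)%:E <=
    (target_potential m v a z t 0)%:E + eta%:E +
    EY (mirror m v a z) (overshoot e))%E
  /\
  ((target_potential m v a z t 0)%:E <=
    P survive + (mirror_potential m v a z t 0)%:E + eta%:E +
    EY (target a z) (overshoot e))%E.
Proof.
move=> /andP[e0 ez] eta0 gap.
have bE s x s0 := @target_potentialE _ m v a z v0 s x s0.
have iE s x s0 := @mirror_potentialE _ m v a z v0 s x s0.
have mb := @measurable_target _ a z. have mi := @measurable_mirror _ m v a z.
have b0 := @target_ge0 _ a z. have i0 := @mirror_ge0 _ m v a z.
have mB := @measurable_target_potential _ m v a z.
have mI := @measurable_mirror_potential _ m v a z.
(* As [e < z], the strip []a, a + e]] misses both []-oo, a - z]] and [[a + z, +oo[], which settles a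
   first passage at the final step. *)
have b_exceed x : a < x <= a + e -> target a z x = 0.
  move=> /andP[ax xe]; rewrite /target indicE memNset// /= in_itv/=; lra.
have i_exceed x : a < x <= a + e -> mirror m v a z x = 0.
  move=> /andP[ax xe]; rewrite /mirror indicE memNset ?mulr0// /= in_itv/= andbT; lra.
have le1 : (EY (target a z) (exceed e) <= EY (mirror m v a z) (exceed e) + eta%:E)%E.
  apply: (@integral_exceed_le e eta _ _ _ _ mb mi mB mI b0 i0 bE iE eta0).
  - by move=> x xe; rewrite b_exceed// i_exceed// add0r.
  - by move=> s x st xe; have := gap s x st xe; rewrite ler_norml; lra.
have le2 : (EY (mirror m v a z) (exceed e) <= EY (target a z) (exceed e) + eta%:E)%E.
  apply: (@integral_exceed_le e eta _ _ _ _ mi mb mI mB i0 b0 iE bE eta0).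
  - by move=> x xe; rewrite b_exceed// i_exceed// add0r.
  - by move=> s x st xe; have := gap s x st xe; rewrite ler_norml; lra.
have bT := integral_reversed_path mb b0 bE.
have iT := integral_reversed_path mi i0 iE.
have bS : EY (target a z) stay = P survive.
  transitivity (\int[P]_(w in stay) (\1_[set w | Y N w <= a - z] w)%:E)%E.
    by apply: eq_integral => w _; rewrite /target !indicE; congr (_%:R%:E).
  have mA : measurable [set w | Y N w <= a - z].
    by have := mY measurableT (measurable_itv `]-oo, a - z]); rewrite setTI.
  by rewrite (integral_indic _ stay_measurable mA) /survive setIC.
have iS : EY (mirror m v a z) stay = 0%E.
  apply: integral0_eq => w Sw; rewrite /mirror indicE memNset ?mulr0//=.
  have := Sw N (leqnn N); rewrite in_itv/= andbT; lra.
move: bT iT; rewrite (split3 e mb b0) (split3 e mi i0) bS iS add0e => bT iT.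
(* Finiteness of all pieces turns the extended real identities into real ones, which can be
   subtracted. *)
have fin (f : R -> R) (F : R -> R -> R) D : measurable D -> measurable_fun setT f ->
    (forall x, 0 <= f x) -> EY f setT = (F t 0)%:E -> EY f D \is a fin_num.
  move=> mD mf f0 fE; rewrite ge0_fin_numE; last first.
    by apply: integral_ge0 => w _; rewrite lee_fin.
  apply: le_lt_trans (ltry (F t 0)); rewrite -fE; apply: ge0_subset_integral => //.
  - by apply/measurable_EFinP; exact: measurableT_comp.
  - by move=> w _; rewrite lee_fin.
have PS : P survive \is a fin_num by apply: fin_num_measure; exact: survive_measurable.
have bEf := fin _ _ _ (exceed_measurable e) mb b0 (integral_reversed_path mb b0 bE).
have bOf := fin _ _ _ (overshoot_measurable e) mb b0 (integral_reversed_path mb b0 bE).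
have iEf := fin _ _ _ (exceed_measurable e) mi i0 (integral_reversed_path mi i0 iE).
have iOf := fin _ _ _ (overshoot_measurable e) mi i0 (integral_reversed_path mi i0 iE).
move: le1 le2 bT iT.
rewrite -(fineK PS) -(fineK bEf) -(fineK bOf) -(fineK iEf) -(fineK iOf).
rewrite -!EFinD !lee_fin => le1 le2 [] bT [] iT.
have bO0 : 0 <= fine (EY (target a z) (overshoot e)).
  by apply: fine_ge0; apply: integral_ge0 => w _; rewrite lee_fin.
have iO0 : 0 <= fine (EY (mirror m v a z) (overshoot e)).
  by apply: fine_ge0; apply: integral_ge0 => w _; rewrite lee_fin.
split; lra.
Qed.

End barrier.

(** * Passage to continuous time *)

Section vanishing.
Local Open Scope ereal_scope.
Context d (T : measurableType d) (R : realType) (mu : {measure set T -> \bar R}).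

(** Dominated convergence: the restrictions of [f] to [S n] tend to 0 pointwise and are bounded by
    [f]. *)
Lemma integral_eventually_out (f : T -> \bar R) (S : nat -> set T) :
  mu.-integrable setT f -> (forall x, 0 <= f x) -> (forall n, measurable (S n)) ->
  (forall x, \forall n \near \oo, ~ S n x) ->
  \int[mu]_(x in S n) f x @[n --> \oo] --> 0.
Proof.
move=> intf f0 mS Sout.
pose f_ n := f \_ (S n).
have mf : measurable_fun setT f by exact: measurable_int intf.
have mf_ n : measurable_fun setT (f_ n).
  apply/(measurable_restrictT f (mS n)).1; exact: measurable_funTS.
have mc : measurable_fun setT (cst 0 : T -> \bar R) by exact: measurable_cst.
have cvgf : {ae mu, forall x, setT x -> f_ ^~ x @ \oo --> cst 0 x}.
  apply: aeW => x _; apply: cvg_near_cst; move: (Sout x).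
  by apply: filterS => n nS; rewrite /f_ patchE memNset.
have domf : {ae mu, forall x n, setT x -> `|f_ n x| <= f x}.
  apply: aeW => x n _; rewrite /f_ patchE; case: ifP => _.
    by rewrite gee0_abs.
  by rewrite abse0.
have [_ _] := dominated_convergence measurableT mf_ mc cvgf intf domf.
rewrite integral_cst// mul0e; apply: cvg_trans.
apply: near_eq_cvg; apply: nearW => n.
by rewrite /f_ [RHS]integral_mkcond.
Qed.

End vanishing.

(** [Q n x] says that the modulus [n.+1%:R^-1] works at [x]. Continuity at a point gives this for
    large [n] on a neighbourhood, and compactness makes one [n] serve the whole segment. *)
Lemma compact_uniform_continuity (R : realType) (f : R -> R) (a b e : R) :
  {within `[a, b], continuous f} -> 0 < e ->
  exists2 r, 0 < r & forall x y, x \in `[a, b] -> y \in `[a, b] ->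
    `|x - y| < r -> `|f x - f y| < e.
Proof.
move=> cf e0.
have /compact_near_coveringP/near_covering_withinP cov := @segment_compact R a b.
pose Q n x := forall y, `[a, b]%classic y -> `|x - y| < n.+1%:R^-1 ->
  `|f x - f y| < e.
have [n _ /(_ n (leqnn n)) nP] : \forall n \near \oo, `[a, b]%classic `<=` Q n.
  apply: cov => x xab.
  have e2 : 0 < e / 2 by rewrite divr_gt0.
  move/subspace_continuousP : cf => /(_ x xab) /cvgrPdist_lt /(_ _ e2).
  move=> [r /= r0 rP].
  have r2 : 0 < r / 2 by rewrite divr_gt0.
  have [n _ nr] : \forall n \near \oo, n.+1%:R^-1 < r / 2.
    exact: near_infty_natSinv_lt (PosNum r2).
  exists ([set y | `|x - y| < r / 2], [set k | (n <= k)%N]).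
    split => /=; last by exists n.
    by exists (r / 2).
  move=> [y k] /= [xy nk] yab u uab yu.
  have xu : `|x - u| < r.
    have := nr k nk; rewrite /= => kr.
    rewrite [r]splitr; apply: (le_lt_trans (ler_distD y x u)).
    exact: ltrD xy (lt_trans yu kr).
  have xy' : `|x - y| < r by apply: lt_trans xy _; lra.
  have fy : `|f x - f y| < e / 2 := rP y xy' yab.
  have fu : `|f x - f u| < e / 2 := rP u xu uab.
  rewrite [e]splitr; apply: (le_lt_trans (ler_distD (f x) (f y) (f u))).
  by apply: ltrD fu; rewrite distrC.
exists n.+1%:R^-1; first by rewrite invr_gt0.
by move=> x y xab yab xy; apply: nP.
Qed.

Lemma affine_path_continuous d (T : measurableType d) (R : realType)
    (P : probability T R) (W : R -> {RV P >-> R}) (m v t : R) (w : T) :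
  brownian_motion W ->
  {within `[0, t], continuous (fun s : R => m * s + v * W s w)}.
Proof.
move=> hW; have /subspace_continuousP Wc := @bm_path _ _ _ _ _ hW w.
apply/subspace_continuousP => s sI.
have s0 : `[0, +oo[%classic s by move: sI; rewrite /= !in_itv/= => /andP[->].
have sub : `[0, t]%classic `<=` `[0, +oo[%classic.
  by move=> u /=; rewrite !in_itv/= => /andP[-> _].
apply: cvgD; first by apply: cvgM; [exact: cvg_cst|exact: cvg_within].
apply: cvgM; first exact: cvg_cst.
apply: cvg_trans (Wc s s0); apply: cvg_app; exact: within_subset.
Qed.

Section limit.
Context d (T : measurableType d) (R : realType) (P : probability T R).
Variables (W : R -> {RV P >-> R}) (hW : brownian_motion W).
Variables (m v a z t : R).
Hypotheses (v0 : 0 < v) (z0 : 0 < z) (t0 : 0 < t) (a0 : 0 <= a).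

Let X s w := m * s + v * W s w.

Let h n : R := t / n.+1%:R.

Let h0 n : 0 < h n. Proof. by rewrite divr_gt0. Qed.

Let hE n : n.+1%:R * h n = t.
Proof. by rewrite mulrC divfK. Qed.

Local Notation Y n := (reversed_path W m v (h n) n.+1).

Let YE n j w : Y n j w = X ((n.+1 - j)%N%:R * h n) w - X t w.
Proof. by rewrite /reversed_path hE. Qed.

Let YN n w : Y n n.+1 w = X 0 w - X t w.
Proof. by rewrite YE subnn mul0r. Qed.

Let hnear r : 0 < r -> \forall n \near \oo, h n < r.
Proof.
move=> r0; have rt : 0 < r / t by rewrite divr_gt0.
apply: filterS (near_infty_natSinv_lt (PosNum rt)) => n /=.
by rewrite ltr_pdivlMr// mulrC.
Qed.

Let X_uniform w e : 0 < e ->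
  exists2 r, 0 < r & forall x y, x \in `[0, t] -> y \in `[0, t] ->
    `|x - y| < r -> `|X x w - X y w| < e.
Proof. exact/compact_uniform_continuity/affine_path_continuous. Qed.

Let grid_itv n i : (i <= n.+1)%N -> i%:R * h n \in `[0, t].
Proof.
move=> iN; rewrite in_itv/= mulr_ge0 ?(ltW (h0 n))//=.
by rewrite -[leRHS](hE n) ler_pM2r// ler_nat.
Qed.

Let grid_near n s : s \in `[0, t] ->
  exists2 i, (i <= n.+1)%N & `|s - i%:R * h n| < h n.
Proof.
rewrite in_itv/= => /andP[s0 st].
have sh0 : 0 <= s / h n by rewrite divr_ge0// ltW.
have /andP[] := truncn_itv sh0; set i := Num.truncn _.
rewrite ler_pdivlMr// ltr_pdivrMr// -natr1 mulrDl mul1r => h1 h2.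
exists i; last by rewrite ger0_norm; lra.
by rewrite -(ler_nat R) -(ler_pM2r (h0 n)) hE (le_trans h1).
Qed.

(** [X 0] is kept in the final condition because [W 0] vanishes only almost surely. *)
Definition barrier_event : set T :=
  [set w | (forall s, s \in `[0, t] -> X s w - X t w <= a) /\
           X 0 w - X t w <= a - z].

Local Notation grid_survive n := (survive W m v a z (h n) n.+1).
Local Notation grid_overshoot n := (overshoot W m v a (h n) n.+1).

Let barrier_sub n : barrier_event `<=` grid_survive n.
Proof.
move=> w [Xa Xz]; split; last by rewrite /= YN.
by move=> j jN; rewrite YE; apply: Xa; apply: grid_itv; rewrite leq_subr.
Qed.

(** The final condition is the same on every grid. A strict passage above [a] at some time persists,
    by uniform continuity, at a close grid time. *)
Let survive_out w : ~ barrier_event w -> \forall n \near \oo, ~ grid_survive n w.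
Proof.
move=> nA.
have [Xz|Xz] := leP (X 0 w - X t w) (a - z); last first.
  by apply: nearW => n [_ /=]; rewrite YN leNgt Xz.
have [s sI Xs] : exists2 s, s \in `[0, t] & a < X s w - X t w.
  apply: contrapT => nex; apply: nA; split => // s sI; rewrite leNgt.
  by apply/negP => H; apply: nex; exists s.
have e0 : 0 < X s w - X t w - a by lra.
have [r r0 rP] := X_uniform w e0.
apply: filterS (hnear r0) => n hr [stayw _].
have [i iN si] := grid_near n sI.
have := rP s (i%:R * h n) sI (grid_itv iN) (lt_trans si hr).
have := stayw (n.+1 - i)%N (leq_subr _ _); rewrite YE subKn//.
by rewrite ltr_norml; lra.
Qed.

(** Once the mesh is below the modulus of continuity for [e], the first grid value above [a] is
    within [e] of its predecessor, which is at most [a]. *)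
Let overshoot_out e w : 0 < e -> \forall n \near \oo, ~ grid_overshoot n e w.
Proof.
move=> e0; have [r r0 rP] := X_uniform w e0.
apply: filterS (hnear r0) => n hr; rewrite /overshoot /= => nSE.
apply: nSE; have [Sw|nSw] := pselect (stay W m v a (h n) n.+1 w); [by left|right].
have ex : exists k, (k <= n.+1)%N && (a < Y n k w).
  apply: contrapT => nex; apply: nSw => j jN; rewrite leNgt; apply/negP => aY.
  by apply: nex; exists j; rewrite jN.
case: (ex_minnP ex) => k /andP[kN aYk] kmin.
exists k; first by rewrite /= ltnS.
have stayed j : (j < k)%N -> Y n j w <= a.
  move=> jk; rewrite leNgt; apply/negP => aYj.
  have := kmin j; rewrite aYj (leq_trans (ltnW jk) kN) => /(_ isT).
  by rewrite leqNgt jk.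
split => //; rewrite aYk/=.
(* A predecessor exists: [Y 0] is 0 and [0 <= a], so the first passage is not at step 0. *)
case: k kN aYk kmin stayed => [_|k kN aYk _ stayed].
  by rewrite YE subn0 hE subrr ltNge a0.
have := stayed k (ltnSn k); rewrite !YE => Yk.
have := rP ((n.+1 - k.+1)%N%:R * h n) ((n.+1 - k)%N%:R * h n)
  (grid_itv (leq_subr _ _)) (grid_itv (leq_subr _ _)).
have nk : (n.+1 - k = (n.+1 - k.+1).+1)%N by rewrite subSS subSn.
rewrite nk -natr1 mulrDl mul1r opprD addNKr normrN gtr0_norm// => /(_ hr).
move: Yk; rewrite nk -natr1 mulrDl mul1r => Yk.
by rewrite ltr_norml; lra.
Qed.

Lemma barrier_event_measurable : measurable barrier_event.
Proof.
rewrite (_ : barrier_event = \bigcap_n grid_survive n).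
  apply: bigcapT_measurable => n; exact: survive_measurable.
apply/seteqP; split => w; first by move=> Aw n _; exact: barrier_sub.
move=> Sw; apply: contrapT => /survive_out[n _ /(_ n (leqnn n))].
by apply; exact: Sw.
Qed.

(** One integrable bound for the three error terms: the constant 1 for a probability, and the final
    values of target and mirror. *)
Let f (w : T) : \bar R :=
  (1 + target a z (X 0 w - X t w) + mirror m v a z (X 0 w - X t w))%:E.

Let b_ge0 y : 0 <= target a z y. Proof. exact: target_ge0. Qed.

Let i_ge0 y : 0 <= mirror m v a z y. Proof. exact: mirror_ge0. Qed.

Let f_integrable : P.-integrable setT f.
Proof.
have mY : measurable_fun setT (fun w => X 0 w - X t w).
  by apply: measurable_funB; apply: measurable_funD => //; exact: measurable_funM.
have one (u : R -> R) (F : R -> R -> R) :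
    measurable_fun setT u -> (forall x, 0 <= u x) ->
    (forall s x, 0 < s ->
      (\int[normal_prob 0 (Num.sqrt s)]_y (u (x - m * s - v * y))%:E = (F s x)%:E)%E) ->
    P.-integrable setT (fun w => (u (X 0 w - X t w))%:E).
  move=> mu u0 uF; apply/integrableP; split.
    by apply/measurable_EFinP; exact: measurableT_comp.
  under eq_integral do rewrite gee0_abs ?lee_fin//.
  (* Only [X 0 - X t] matters, so the grid with a single step suffices. *)
  have uE := integral_reversed_path hW (h0 0) (ltn0Sn 0) mu u0 uF.
  apply: le_lt_trans (ltry (F (1%:R * h 0) 0)); rewrite -uE le_eqVlt.
  by apply/orP; left; apply/eqP; apply: eq_integral => w _; rewrite (YN 0).
rewrite (_ : f = (cst 1%:E \+ (fun w => (target a z (X 0 w - X t w))%:E) \+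
    (fun w => (mirror m v a z (X 0 w - X t w))%:E))%E); last first.
  by apply/funext => w; rewrite /f !EFinD.
apply: integrableD => //.
  apply: integrableD => //; first exact: finite_measure_integrable_cst.
  apply: (one _ (target_potential m v a z)) => //; first exact: measurable_target.
  by move=> s x s0; exact: target_potentialE.
apply: (one _ (mirror_potential m v a z)) => //; first exact: measurable_mirror.
by move=> s x s0; exact: mirror_potentialE.
Qed.

Theorem barrier_probability : P barrier_event =
  (target_potential m v a z t 0 - mirror_potential m v a z t 0)%:E.
Proof.
set b := target_potential _ _ _ _ _ _; set i := mirror_potential _ _ _ _ _ _.
have mA := barrier_event_measurable.
have f0 w : (0 <= f w)%E by rewrite lee_fin !addr_ge0.
(* One [eta] each for the gap between the potentials, the overshoot, and the paths that survive on
   the grid only. *)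
suff H : forall eta : R, 0 < eta -> `|fine (P barrier_event) - (b - i)| <= 3 * eta.
  rewrite -[LHS]fineK ?fin_num_measure//; congr EFin; apply/eqP.
  rewrite -subr_eq0 -normr_le0; apply/ler_addgt0Pr => e e0; rewrite add0r.
  have e3 : 0 < e / 3 by rewrite divr_gt0.
  by apply: le_trans (H _ e3) _; lra.
move=> eta eta0.
have [e /andP[e0 ez] gap] := @potential_gap _ m v a z v0 t eta z0 t0 eta0.
(* The exceptional paths of the grid; each path is exceptional for finitely many [n] only, so the
   integral of [f] over [S n] vanishes in the limit. *)
pose S n := (grid_survive n `\` barrier_event) `|` grid_overshoot n e.
have mS n : measurable (S n).
  apply: measurableU; last exact: overshoot_measurable.
  by apply: measurableD => //; exact: survive_measurable.
have Sout w : \forall n \near \oo, ~ S n w.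
  have [Aw|nAw] := pselect (barrier_event w).
    by apply: filterS (overshoot_out w e0) => n nO [[_ /(_ Aw)]|/nO].
  apply: filterS2 (overshoot_out w e0) (survive_out nAw) => n nO nS.
  by move=> [[/nS]|/nO].
have Slim := integral_eventually_out f_integrable f0 mS Sout.
have [n fn] : exists n, (\int[P]_(w in S n) f w <= eta%:E)%E.
  have : \forall n \near \oo, (\int[P]_(w in S n) f w < eta%:E)%E.
    have /fine_cvgP[Sfin /cvgr_lt Slt] := Slim.
    apply: filterS2 Sfin (Slt _ eta0) => n Sf /= Sn.
    by rewrite -(fineK Sf) lte_fin.
  by move=> [n _ /(_ n (leqnn n)) /= /ltW]; exists n.
have mf D : measurable_fun D f.
  by apply: measurable_funTS; exact: measurable_int f_integrable.
have small (D : set T) (u : T -> \bar R) : measurable D -> D `<=` S n ->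
    measurable_fun D u -> (forall w, 0 <= u w <= f w)%E ->
    (\int[P]_(w in D) u w <= eta%:E)%E.
  move=> mD DS mu uf; apply: le_trans fn.
  apply: (@le_trans _ _ (\int[P]_(w in D) f w)%E).
    apply: ge0_le_integral => //.
    - by move=> w _; have /andP[] := uf w.
    - by move=> w _; have /andP[] := uf w.
  exact: ge0_subset_integral.
have mO := overshoot_measurable W m v a (h n) n.+1 e.
have OS : grid_overshoot n e `<=` S n by move=> w; right.
have DS : grid_survive n `\` barrier_event `<=` S n by move=> w; left.
have mD : measurable (grid_survive n `\` barrier_event).
  by apply: measurableD => //; exact: survive_measurable.
have mY : measurable_fun setT (Y n n.+1) by exact: reversed_path_measurable.
have PD : (P (grid_survive n `\` barrier_event) <= eta%:E)%E.
  rewrite -[leLHS]mul1e -integral_cst//; apply: small => // w.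
  by rewrite !lee_fin ler01/= -addrA lerDl addr_ge0.
have bO :
    (\int[P]_(w in grid_overshoot n e) (target a z (Y n n.+1 w))%:E <= eta%:E)%E.
  apply: small => //.
    apply/measurable_EFinP/measurable_funTS.
    exact: (measurableT_comp (measurable_target a z)).
  by move=> w; rewrite !lee_fin b_ge0 YN; have := i_ge0 (X 0 w - X t w); lra.
have iO :
    (\int[P]_(w in grid_overshoot n e) (mirror m v a z (Y n n.+1 w))%:E <= eta%:E)%E.
  apply: small => //.
    apply/measurable_EFinP/measurable_funTS.
    exact: (measurableT_comp (measurable_mirror m v a z)).
  by move=> w; rewrite !lee_fin i_ge0 YN; have := b_ge0 (X 0 w - X t w); lra.
have [] := @survive_estimate _ _ _ P W hW m v a z (h n) n.+1 v0 (h0 n) (ltn0Sn n)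
  e eta _ (ltW eta0).
- by rewrite e0.
- by rewrite hE.
rewrite hE -/b -/i => up lo.
have PS : P (grid_survive n) =
    (P barrier_event + P (grid_survive n `\` barrier_event))%E.
  by rewrite -measureU ?setDIK// setDUK//; exact: barrier_sub.
have PAf : P barrier_event \is a fin_num by exact: fin_num_measure.
have PDf : P (grid_survive n `\` barrier_event) \is a fin_num.
  by exact: fin_num_measure.
have up' : (P barrier_event + P (grid_survive n `\` barrier_event) + i%:E <=
    b%:E + eta%:E + eta%:E)%E.
  by rewrite -PS; apply: le_trans up _; rewrite leeD2l.
have lo' : (b%:E <= P barrier_event + P (grid_survive n `\` barrier_event) + i%:E +
    eta%:E + eta%:E)%E.
  by rewrite -PS; apply: le_trans lo _; rewrite leeD2l.
have PD0 : (0 <= P (grid_survive n `\` barrier_event))%E by [].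
move: up' lo' PD PD0; rewrite -(fineK PAf) -(fineK PDf) -!EFinD !lee_fin.
by move=> *; rewrite ler_norml; lra.
Qed.

End limit.

(** * From the barrier event to the distribution function of the drawdown *)

Definition drawdown_cdf {R : realType} (m v z t a : R) : R :=
  Phi ((a - z + t * m) / (Num.sqrt t * v))
  - expR (- 2 * a * (m / v ^+ 2)) * Phi ((- a - z + t * m) / (Num.sqrt t * v)).

Lemma Phi_continuous {R : realType} : continuous (@Phi R).
Proof.
move=> x; apply/differentiable_continuous/derivable1_diffP.
by have /@ex_derive := is_derive_Phi x.
Qed.

(** The initial drawdown and the level may move together, as needed for the limit [y --> 0] at level
    [a + y]. *)
Lemma drawdown_cdf_cvg {R : realType} (m v z t a : R) (f g : R -> R) (x : R) :
  f u @[u --> x] --> z -> g u @[u --> x] --> a ->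
  drawdown_cdf m v (f u) t (g u) @[u --> x] --> drawdown_cdf m v z t a.
Proof.
move=> fz ga.
have Phi_cvg (k : R -> R) (k0 : R) : k u @[u --> x] --> k0 ->
    Phi (k u) @[u --> x] --> Phi k0.
  by move=> kk; apply: continuous_cvg => //; exact: Phi_continuous.
apply: cvgB.
  apply: Phi_cvg; apply: cvgM; last exact: cvg_cst.
  by apply: cvgD; [exact: cvgB|exact: cvg_cst].
apply: cvgM.
  apply: continuous_cvg; first exact: continuous_expR.
  by apply: cvgM; [apply: cvgM => //; exact: cvg_cst|exact: cvg_cst].
apply: Phi_cvg; apply: cvgM; last exact: cvg_cst.
by apply: cvgD; [apply: cvgB => //; exact: cvgN|exact: cvg_cst].
Qed.

Section barrier0.
Context d (T : measurableType d) (R : realType) (P : probability T R).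
Variables (W : R -> {RV P >-> R}) (hW : brownian_motion W).
Variables (m v t : R).
Hypotheses (v0 : 0 < v) (t0 : 0 < t).

Lemma barrier_probability_cdf (a z : R) : 0 <= a -> 0 <= z ->
  P (barrier_event W m v a z t) = (drawdown_cdf m v z t a)%:E.
Proof.
have pos b y : 0 <= b -> 0 < y ->
    P (barrier_event W m v b y t) = (drawdown_cdf m v y t b)%:E.
  move=> b0 y0; rewrite (barrier_probability hW m v0 y0 t0 b0).
  rewrite /target_potential /mirror_potential /drawdown_cdf.
  congr (_ - expR _ * _)%:E.
  - by rewrite subr0 [t * m]mulrC.
  - by rewrite sub0r; field; rewrite gt_eqF.
  - by rewrite sub0r [t * m]mulrC.
move=> a0; rewrite le_eqVlt => /predU1P[<-|]; last exact: pos.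
have mB b y := barrier_event_measurable hW m v b y t0.
have Bfin b y : P (barrier_event W m v b y t) \is a fin_num by exact: fin_num_measure.
(* The drawdown is monotone and 1-Lipschitz in the initial value, which gives
   the case [z = 0] by continuity of the distribution function. *)
have lo y : 0 < y -> drawdown_cdf m v y t a <= fine (P (barrier_event W m v a 0 t)).
  move=> y0; rewrite -lee_fin -pos// fineK//; apply: le_measure; rewrite ?inE//.
  by move=> w [Xa Xy]; split => //; rewrite subr0; lra.
have up y : 0 < y ->
    fine (P (barrier_event W m v a 0 t)) <= drawdown_cdf m v y t (a + y).
  move=> y0; rewrite -lee_fin -pos ?fineK//; last by rewrite addr_ge0// ltW.
  apply: le_measure; rewrite ?inE//.
  move=> w [Xa Xy]; split; last by rewrite addrK -[a]subr0.
  by move=> s sI; have := Xa s sI; lra.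
rewrite -[LHS]fineK//; congr EFin; apply/le_anti/andP; split; apply/ler_addgt0Pr => e e0.
  have : drawdown_cdf m v y t (a + y) @[y --> 0] --> drawdown_cdf m v 0 t (a + 0).
    by apply: drawdown_cdf_cvg; [exact: cvg_id|apply: cvgD; [exact: cvg_cst|exact: cvg_id]].
  rewrite addr0 => /cvgrPdist_le/(_ _ e0)[r /= r0 /(_ (r / 2))] /=.
  rewrite sub0r normrN gtr0_norm ?divr_gt0// => /(_ ltac:(lra)).
  have := up (r / 2) ltac:(lra).
  by rewrite ler_norml; lra.
have : drawdown_cdf m v y t a @[y --> 0] --> drawdown_cdf m v 0 t a.
  by apply: drawdown_cdf_cvg; [exact: cvg_id|exact: cvg_cst].
move=> /cvgrPdist_le/(_ _ e0)[r /= r0 /(_ (r / 2))] /=.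
rewrite sub0r normrN gtr0_norm ?divr_gt0// => /(_ ltac:(lra)).
have := lo (r / 2) ltac:(lra).
by rewrite ler_norml; lra.
Qed.

End barrier0.

Section drawdown_rv.
Context d (T : measurableType d) (R : realType) (P : probability T R).
Variables (W : R -> {RV P >-> R}) (hW : brownian_motion W).
Variables (eta theta sigma b z t : R).
Hypothesis t0 : 0 < t.

Local Notation X := (surplus W eta theta sigma b).
Local Notation D := (drawdown W eta theta sigma b z t).
Local Notation B a :=
  (barrier_event W (drift eta theta b) (volatility sigma b) a 0 t).

(** A maximum is bounded when both its arguments are. The event is taken with initial value 0, so
    that its final condition is the case [s = 0] of its first one. *)
Let D_leP w (a : R) : D w <= a <-> z - X t w <= a /\ B a w.
Proof.
set S := [set X s w | s in `[0, t]].
have tt : t \in `[0, t] by rewrite in_itv/= lexx ltW.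
have S0 : S !=set0 by exists (X t w); exists t.
(* The continuous path is bounded on [[0, t]], so [sup] is a true supremum and not a default
   value. *)
have [c cI cP] := EVT_max (ltW t0)
  (@affine_path_continuous _ _ _ _ W (drift eta theta b) (volatility sigma b) t w hW).
have Sub : has_ubound S by exists (X c w) => _ [s sI <-]; exact: cP.
rewrite /drawdown -/S lerBlDr ge_max -lerBlDr; split.
  move=> /andP[za Sa]; split => //.
  have Xa s : s \in `[0, t] -> X s w - X t w <= a.
    by move=> sI; rewrite lerBlDr (le_trans _ Sa)//; apply: ub_le_sup => //; exists s.
  by split => //; rewrite subr0; apply: Xa; rewrite in_itv/= lexx ltW.
move=> [za [Xa _]]; rewrite za/=; apply: ge_sup => // _ [s sI <-].
by rewrite -lerBlDr; exact: Xa.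
Qed.

Let X_measurable s : measurable_fun setT (X s).
Proof. by apply: measurable_funD => //; exact: measurable_funM. Qed.

Lemma measurable_drawdown : measurable_fun setT D.
Proof.
apply: (measurability _ (RGenOInfty.measurableE R)) => //= _ [_ [a ->] <-].
rewrite setTI (_ : _ @^-1` _ =
    ~` (((fun w => z - X t w) @^-1` `]-oo, a]) `&` B a)); last first.
  apply/seteqP; split => w /=; rewrite !in_itv/= andbT.
    by move=> aD Dw; have /D_leP := Dw; rewrite leNgt aD.
  by move=> nD; rewrite ltNge; apply/negP => /D_leP.
apply: measurableC; apply: measurableI; last exact: barrier_event_measurable.
have mzX : measurable_fun setT (fun w => z - X t w) by exact: measurable_funB.
by rewrite -[_ @^-1` _]setTI; exact: mzX.
Qed.

(** The two events differ only inside the null set [N] outside which [X 0 = 0]; adding [N] to both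
    makes them equal. *)
Lemma probability_drawdown_le (a : R) :
  P [set w | D w <= a] =
  P (barrier_event W (drift eta theta b) (volatility sigma b) a z t).
Proof.
have mDa : measurable [set w | D w <= a].
  by have := measurable_drawdown measurableT (measurable_itv `]-oo, a]); rewrite setTI.
have mB := barrier_event_measurable hW (drift eta theta b) (volatility sigma b) a z t0.
have [N [mN PN subN]] := bm_start hW.
rewrite -(measureU0 mDa mN PN) -(measureU0 mB mN PN); congr (P _).
have X0 w : ~ N w -> X 0 w = 0.
  move=> nNw; rewrite /surplus mulr0 add0r.
  rewrite (_ : W 0 w = 0) ?mulr0//.
  by apply: contrapT => W0; apply: nNw; exact: subN.
apply/seteqP; split => w [|Nw]; try by right.
  move=> /D_leP[za [Xa _]]; have [Nw|/X0 nNw] := pselect (N w); [by right|left].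
  by split => //; rewrite -/(X 0 w) nNw; move: za; rewrite -/(X t w); lra.
move=> [Xa Xz]; have [Nw|/X0 nNw] := pselect (N w); [by right|left].
apply/D_leP; split; first by move: Xz; rewrite -/(X 0 w) -/(X t w) nNw; lra.
by split => //; rewrite subr0; apply: Xa; rewrite in_itv/= lexx ltW.
Qed.

End drawdown_rv.

(** * The density *)

Section density_of_cdf.
Context d (T : measurableType d) (R : realType) (P : probability T R).
Variables (X : {RV P >-> R}) (F f : R -> R).
Hypotheses (fc : continuous f) (Ff : forall x : R, is_derive x 1 F (f x)).
Hypotheses (F0 : F 0 = 0) (XF : forall x : R, 0 <= x -> cdf X x = (F x)%:E).

Local Notation mu := (@lebesgue_measure R).
Local Notation fpos := (fun x => f x * \1_[set x : R | 0 < x] x).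

Let F_le (x y : R) : 0 <= x -> x <= y -> F x <= F y.
Proof.
move=> x0 xy; rewrite -lee_fin -!XF//; first exact: cdf_nondecreasing.
exact: le_trans xy.
Qed.

(** [F] is nondecreasing on the positive half-line; adding [e *: id] makes it strictly increasing
    there, so [f x + e] is nonnegative for every [e > 0]. *)
Let f_ge0 (x : R) : 0 < x -> 0 <= f x.
Proof.
move=> x0; apply/ler_addgt0Pr => e e0; rewrite addrC.
pose G : R -> R := F + (e *: id).
have GE (y : R) : is_derive y 1 G (f y + e).
  have := is_deriveD (Ff y) (is_deriveZ e (is_derive_id y (1 : R))).
  by rewrite [_ *: _]mulr1.
have := @incr_derive1_ge0_itvy R G true 0 x.
rewrite derive1E derive_val addrC; apply.
- by move=> y _.
- move=> y y'; rewrite !in_itv/= !andbT => y0 y'0 yy'.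
  by apply: ler_ltD; [apply: F_le => //; exact: ltW|rewrite /GRing.scale/= ltr_pM2l].
- by rewrite in_itv/= x0.
Qed.

Let fpos_ge0 x : 0 <= fpos x.
Proof.
rewrite /= indicE; have [x0|x0] := ltP 0 x.
  by rewrite mem_set// mulr1 f_ge0.
by rewrite memNset ?mulr0//= ltNge x0.
Qed.

Let fpos_measurable : measurable_fun setT fpos.
Proof.
apply: measurable_funM; first exact: continuous_measurable_fun.
apply: measurable_indic.
rewrite (_ : mkset _ = `]0, +oo[%classic) //.
by apply/seteqP; split => x /=; rewrite in_itv/= andbT.
Qed.

Let cdf_neg x : x < 0 -> cdf X x = 0%E.
Proof.
move=> x0; apply/eqP; rewrite eq_le cdf_ge0 andbT.
by rewrite -[leRHS]/((0 : R)%:E) -F0 -XF// cdf_nondecreasing// ltW.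
Qed.

Let integral_fpos x : (\int[mu]_(u in `]-oo, x]) (fpos u)%:E = cdf X x)%E.
Proof.
have [x0|x0] := leP x 0.
  rewrite integral0_eq.
    move: x0; rewrite le_eqVlt => /predU1P[->|/cdf_neg //].
    by rewrite XF// F0.
  move=> u; rewrite /= in_itv/= => ux; rewrite indicE memNset ?mulr0//=.
  by apply/negP; rewrite -leNgt (le_trans ux).
rewrite XF ?ltW// -[F x]subr0 -[X in _ - X]F0 EFinB.
rewrite -(@continuous_FTC2 R f F 0 x x0).
- rewrite -integral_itv_obnd_cbnd; last first.
    by apply/measurable_EFinP/measurable_funTS; exact: continuous_measurable_fun.
  rewrite integral_mkcond [RHS]integral_mkcond; apply: eq_integral => u _.
  rewrite !patchE !mem_setE !in_itv/= indicE.
  have [u0|u0] := ltP 0 u.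
    by rewrite mem_set//= mulr1.
  by rewrite memNset ?mulr0 ?if_same//= ltNge u0.
- exact: continuous_subspaceT.
- split.
  + by move=> y _; exact: ex_derive.
  + apply: cvg_at_right_filter; apply/differentiable_continuous/derivable1_diffP.
    exact: ex_derive.
  + apply: cvg_at_left_filter; apply/differentiable_continuous/derivable1_diffP.
    exact: ex_derive.
- by move=> y _; rewrite derive1E derive_val.
Qed.

(** By [integral_fpos] the law and the measure with density [fpos] agree on the rays []-oo, x]],
    which are closed under intersection, generate the Borel sets and exhaust the line. *)
Lemma has_density_of_cdf : has_density (distribution P X) fpos.
Proof.
split; [exact: fpos_measurable|exact: fpos_ge0|move=> A mA].
pose nu A := (\int[mu]_(u in A) (fpos u)%:E)%E.
have nu0 : nu set0 = 0%E by exact: integral_set0.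
have nu_ge0 B : (0 <= nu B)%E.
  by apply: integral_ge0 => u _; rewrite lee_fin fpos_ge0.
have mfpos : measurable_fun setT (EFin \o fpos).
  by apply/measurable_EFinP; exact: fpos_measurable.
have nu_sigma : @semi_sigma_additive _ R R nu.
  have f0 u : (0 <= (EFin \o fpos) u)%E by rewrite lee_fin fpos_ge0.
  exact: (@semi_sigma_additive_nng_induced _ _ _ mu _ mfpos f0).
pose nuM : {measure set R -> \bar R} :=
  HB.pack nu (isMeasure.Build _ R R nu nu0 nu_ge0 nu_sigma).
pose G : set (set R) := [set B | exists x, B = `]-oo, x]%classic].
have Gm : G `<=` measurable by move=> _ [x ->]; exact: measurable_itv.
have GA : <<s G >> A.
  have : (@RGenOInfty.G R).-sigma.-measurable A by rewrite -RGenOInfty.measurableE.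
  apply: smallest_sub; first exact: smallest_sigma_algebra.
  move=> _ [x ->]; rewrite -setCitvl; apply: (@measurableC _ (g_sigma_algebraType G)).
  by apply: sub_sigma_algebra; exists x.
apply: (@g_sigma_algebra_measure_unique _ R R G Gm (fun k => `]-oo, k%:R]%classic)
  _ _ (distribution P X) nuM _ _ _ A GA).
- by move=> k; exists k%:R.
- apply/seteqP; split => // x _; exists (Num.truncn `|x|).+1 => //=.
  by rewrite in_itv/= (le_trans (ler_norm x))// ltW// truncnS_gt.
- move=> _ _ [x ->] [y ->]; exists (Num.min x y).
  by apply/seteqP; split => u /=; rewrite !in_itv/= le_min => /andP.
- by move=> _ [x ->]; rewrite /nuM/= /nu integral_fpos.
- by move=> k; rewrite (le_lt_trans (probability_le1 _ _)) ?ltry.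
Qed.

End density_of_cdf.

Section drawdown_density.
Context {R : realType}.
Variables (m v z t : R).
Hypotheses (v0 : 0 < v) (t0 : 0 < t).

Definition drawdown_density (x : R) : R :=
  (Num.sqrt (2 * pi * t) * v)^-1
    * (expR (- ((x + z + t * m) ^+ 2 - 4 * t * m * z) / (2 * t * v ^+ 2))
       + expR (- (x - z + m * t) ^+ 2 / (2 * t * v ^+ 2)))
  + 2 * m / v ^+ 2 * Phi ((t * m - x - z) / (Num.sqrt t * v))
    * expR (- 2 * x * m / v ^+ 2).

Let q := Num.sqrt t * v.

Let q0 : 0 < q. Proof. by rewrite mulr_gt0// sqrtr_gt0. Qed.

Let q2 : q ^+ 2 = t * v ^+ 2. Proof. by rewrite exprMn sqr_sqrtr// ltW. Qed.

Let pdfE y : normal_pdf 0 1 (y / q) / q =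
  (Num.sqrt (2 * pi * t) * v)^-1 * expR (- y ^+ 2 / (2 * t * v ^+ 2)).
Proof.
rewrite normal_pdfE ?oner_neq0// /normal_peak /normal_fun subr0 expr1n mul1r.
rewrite (sqrtrM t) ?mulr_ge0 ?pi_ge0// -mulrA -/q invfM -[pi *+ 2]mulr_natl.
rewrite mulrAC; congr (_ * expR _).
  by rewrite /q !invfM.
rewrite (_ : (Num.sqrt t)^-1 / v = q^-1); last by rewrite /q invfM.
rewrite exprMn exprVn q2.
by field; rewrite !gt_eqF.
Qed.

Lemma is_derive_drawdown_cdf (x : R) :
  is_derive x 1 (drawdown_cdf m v z t) (drawdown_density x).
Proof.
pose l1 (y : R) := (y - z + t * m) / q.
pose l2 (y : R) := (- y - z + t * m) / q.
pose l3 (y : R) := - 2 * y * (m / v ^+ 2).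
have d1 : is_derive x 1 l1 q^-1.
  by apply: is_derive_eq; rewrite /GRing.scale/=; ring.
have d2 : is_derive x 1 l2 (- q^-1).
  by apply: is_derive_eq; rewrite /GRing.scale/=; ring.
have d3 : is_derive x 1 l3 (- 2 * (m / v ^+ 2)).
  by apply: is_derive_eq; rewrite /GRing.scale/=; ring.
have -> : drawdown_density x = normal_pdf 0 1 (l1 x) * q^-1 -
    (expR (l3 x) * (normal_pdf 0 1 (l2 x) * (- q^-1)) +
     Phi (l2 x) * (expR (l3 x) * (- 2 * (m / v ^+ 2)))).
  have e1 : (Num.sqrt (2 * pi * t) * v)^-1 *
      expR (- (x - z + m * t) ^+ 2 / (2 * t * v ^+ 2)) = normal_pdf 0 1 (l1 x) / q.
    by rewrite [m * t]mulrC pdfE.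
  (* The exponents match because (x + z - t m)^2 + 4 t m x = (x + z + t m)^2 - 4 t m z. *)
  have e2 : (Num.sqrt (2 * pi * t) * v)^-1 *
      expR (- ((x + z + t * m) ^+ 2 - 4 * t * m * z) / (2 * t * v ^+ 2)) =
      expR (l3 x) * (normal_pdf 0 1 (l2 x) / q).
    rewrite pdfE [RHS]mulrCA -expRD; congr (_ * expR _).
    by rewrite /l3; field; rewrite !gt_eqF.
  have e3 : (t * m - x - z) / (Num.sqrt t * v) = l2 x by rewrite /l2 /q; ring.
  have e4 : - 2 * x * m / v ^+ 2 = l3 x by rewrite /l3; ring.
  by rewrite /drawdown_density mulrDr e1 e2 e3 e4; ring.
have D1 := is_derive1_comp (is_derive_Phi (l1 x)) d1.
have D2 := is_derive1_comp (is_derive_Phi (l2 x)) d2.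
have D3 := is_derive1_comp (is_derive_expR (l3 x)) d3.
exact: is_deriveB D1 (is_deriveM D3 D2).
Qed.

Lemma continuous_drawdown_density : continuous drawdown_density.
Proof.
move=> x; have id_x : u @[u --> x] --> x by exact: cvg_id.
have cst_x (c : R) : c @[u --> x] --> c by exact: cvg_cst.
have expR_x (k : R -> R) : k u @[u --> x] --> k x ->
    expR (k u) @[u --> x] --> expR (k x).
  by move=> kx; apply: continuous_cvg => //; exact: continuous_expR.
have sqr_x (k : R -> R) : k u @[u --> x] --> k x ->
    k u ^+ 2 @[u --> x] --> k x ^+ 2.
  by move=> kx; exact: (cvgM kx kx).
apply: cvgD.
  apply: cvgM => //; apply: cvgD; apply: expR_x; apply: cvgM => //; apply: cvgN.
    by apply: cvgB => //; apply: sqr_x; do 2 apply: cvgD => //.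
  by apply: sqr_x; apply: cvgD => //; exact: cvgB.
apply: cvgM.
  apply: cvgM => //; apply: continuous_cvg; first exact: Phi_continuous.
  by apply: cvgM => //; do 2 apply: cvgB => //.
by apply: expR_x; do 3 apply: cvgM => //.
Qed.

Lemma drawdown_cdf0 : drawdown_cdf m v z t 0 = 0.
Proof.
by rewrite /drawdown_cdf oppr0 mulr0 mul0r expR0 mul1r subrr.
Qed.

End drawdown_density.

Theorem lemma2p4 (d : measure_display) (T : measurableType d) (R : realType)
    (P : probability T R) (W : R -> {RV P >-> R}) (eta theta sigma b z t : R)
    (hW : brownian_motion W) (hetatheta : eta < theta) (hsigma : 0 < sigma)
    (hb0 : 0 < b) (hb1 : b <= 1) (hz : 0 <= z) (ht : 0 < t) :
  let m := drift eta theta b in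
  let v := volatility sigma b in
  exists D : {RV P >-> R},
    [/\ forall w, D w = drawdown W eta theta sigma b z t w,
        forall delta : R, 0 <= delta ->
          cdf D delta =
          (Phi ((delta - z + t * m) / (Num.sqrt t * v))
           - expR (- 2 * delta * (m / v ^+ 2))
             * Phi ((- delta - z + t * m) / (Num.sqrt t * v)))%:E
      & has_density (distribution P D) (fun delta : R =>
          ((Num.sqrt (2 * pi * t) * v)^-1
             * (expR (- ((delta + z + t * m) ^+ 2 - 4 * t * m * z)
                        / (2 * t * v ^+ 2))
                + expR (- (delta - z + m * t) ^+ 2 / (2 * t * v ^+ 2)))
           + 2 * m / v ^+ 2 * Phi ((t * m - delta - z) / (Num.sqrt t * v))
             * expR (- 2 * delta * m / v ^+ 2))
          * \1_[set x : R | 0 < x] delta)].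
Proof.
move=> m v.
have v0 : 0 < v by rewrite mulr_gt0.
pose D : {RV P >-> R} :=
  mfun_Sub (mem_set (measurable_drawdown hW eta theta sigma b z ht)).
have DE w : D w = drawdown W eta theta sigma b z t w by [].
have cdfE delta : 0 <= delta -> cdf D delta = (drawdown_cdf m v z t delta)%:E.
  move=> d0; rewrite -(barrier_probability_cdf hW m v0 ht d0 hz).
  rewrite -(probability_drawdown_le hW eta theta sigma b z ht delta).
  by congr (P _); apply/seteqP; split => w; rewrite /= in_itv.
exists D; split; [exact: DE|exact: cdfE|].
(* The distribution function vanishes at 0, so there is no atom there and its derivative on the
   positive half-line carries all the mass. *)
exact: (has_density_of_cdf (@continuous_drawdown_density R m v z t)
  (is_derive_drawdown_cdf m z v0 ht) (drawdown_cdf0 m v z t) cdfE).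
Qed.
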